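(* If $\pi$ is a plane in $\mathrm{PG}(5,q)$ which is disjoint from the Veronese surface $\mathcal{V}(\mathbb{F}_q)$, and meets the nucleus plane of $\mathcal{V}(\mathbb{F}_q)$ in a point $P$, with $H(P)=H(\pi)$, then $\pi$ belongs to one of three $K$-orbits $\Sigma_{18}$, $\Sigma_{19}$, and $\Sigma_{20}$, with $OD_0(\Sigma_{18})=[0,1,0,q^2+q]$, $OD_0(\Sigma_{19})=[0,1,3q,q^2-2q]$, and $OD_0(\Sigma_{20})=[0,1,q,q^2]$. Representatives are $\Sigma_{18}:[x,y,z;\ y,cz,x+z;\ z,x+z,\cdot]$ with $c\in\mathbb{F}_q$ such that $X^3+X+c$ has no root in $\mathbb{F}_q$ and $\operatorname{Tr}(c^{-1})=\operatorname{Tr}(1)$; $\Sigma_{19}:[x,y,\cdot;\ y,y+z,z;\ \cdot,z,x]$; $\Sigma_{20}:[x,y,bx;\ y,cx+y+z,z;\ bx,z,x]$ with $b\neq1$ and $\operatorname{Tr}(c/(1+b^2))=1$.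
   Context: Let $q$ be even ($q\ge4$ for the uniqueness of $H(\pi)$). The Veronese surface $\mathcal{V}(\mathbb{F}_q)\subset\mathrm{PG}(5,q)$ is the image of $(u_0,u_1,u_2)\mapsto(u_0^2,u_0u_1,u_0u_2,u_1^2,u_1u_2,u_2^2)$; a point $(y_0,\dots,y_5)$ is identified with the symmetric matrix $[y_0,y_1,y_2;\ y_1,y_3,y_4;\ y_2,y_4,y_5]$ and has the rank of this matrix; planes are written as symmetric matrices with entries linear forms in $x,y,z$ (''$\cdot$'' = zero). $K\cong\mathrm{PGL}(3,q)$ acts by $M\mapsto AMA^T$. $\operatorname{Tr}$ is the trace $\mathbb{F}_q\to\mathbb{F}_2$. The nucleus plane $\pi_{\mathcal{N}}=\mathcal{Z}(Y_0,Y_3,Y_5)$; for $P\in\pi_{\mathcal{N}}$, $\mathcal{C}(P)$ is the conic of $\mathcal{V}(\mathbb{F}_q)$ with nucleus $P$. $\mathcal{H}_1$ is the $K$-orbit of hyperplanes corresponding to double lines of $\mathrm{PG}(2,q)$ (each meets $\mathcal{V}(\mathbb{F}_q)$ in a conic); $H(P)$ is the unique hyperplane of $\mathcal{H}_1$ containing $\mathcal{C}(P)$. For a plane $\pi$ disjoint from $\mathcal{V}(\mathbb{F}_q)$ meeting $\pi_{\mathcal{N}}$ in a single point, there is a unique hyperplane of $\mathcal{H}_1$ containing $\pi$, denoted $H(\pi)$. $OD_0(\pi)=[r_1,r_{2,n},r_{2,s},r_3]$ counts rank-1 points, points of $\pi\cap\pi_{\mathcal{N}}$, rank-2 points outside $\pi_{\mathcal{N}}$,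 and rank-3 points of $\pi$. *)

(* Defs.v *)
From HB Require Import structures.
From mathcomp Require Import all_boot all_order all_fingroup all_algebra.
From mathcomp Require Import all_solvable all_field.

Set Implicit Arguments.
Unset Strict Implicit.
Unset Printing Implicit Defensive.

Import GRing.Theory.
Local Open Scope ring_scope.

(* PG(5,q) is the projective space of the row space 'rV[F]_6: a projective    *)
(* subspace of dimension d is a {vspace 'rV[F]_6} of dimension d + 1, and the *)
(* point with homogeneous coordinates v is the set of all multiples of v.     *)

Section ProjectiveSpace.

Variable F : fieldType.
Implicit Types (y a : 'rV[F]_6) (u l : 'rV[F]_3) (M : 'M[F]_3).

Definition mx3 (s : seq (seq F)) : 'M[F]_3 :=
  \matrix_(i, j) nth 0 (nth [::] s i) j.

Definition row6 (s : seq F) : 'rV[F]_6 := \row_k nth 0 s k.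

(* The identification (y_0, ..., y_5) <-> symmetric 3 x 3 matrix. *)
Definition symmx y : 'M[F]_3 :=
  mx3 [:: [:: y 0 0; y 0 1; y 0 2];
          [:: y 0 1; y 0 3; y 0 4];
          [:: y 0 2; y 0 4; y 0 5]].

Definition symcoord M : 'rV[F]_6 :=
  row6 [:: M 0 0; M 0 1; M 0 2; M 1 1; M 1 2; M 2 2].

Definition veronese u : 'rV[F]_6 :=
  row6 [:: u 0 0 ^+ 2; u 0 0 * u 0 1; u 0 0 * u 0 2;
           u 0 1 ^+ 2; u 0 1 * u 0 2; u 0 2 ^+ 2].

(* The subspace Z(a_0 Y_0 + ... + a_5 Y_5); a hyperplane when a != 0. *)
Definition zeros a : {vspace 'rV[F]_6} := lker (linfun (mulmxr a^T)).

Definition nucleus_plane : {vspace 'rV[F]_6} :=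
  let Z k := zeros (delta_mx 0 k) in (Z 0%R :&: Z 3%R :&: Z 5%R)%VS.

(* The hyperplane Z(\sum_k a_k Y_k) corresponds to the conic                  *)
(*   a_0 X_0^2 + a_1 X_0 X_1 + a_2 X_0 X_2                                    *)
(*             + a_3 X_1^2 + a_4 X_1 X_2 + a_5 X_2^2 = 0 of PG(2,q);          *)
(* below are the coefficients of (l_0 X_0 + l_1 X_1 + l_2 X_2)^2.             *)
Definition double_line l : 'rV[F]_6 :=
  row6 [:: l 0 0 ^+ 2; (l 0 0 * l 0 1) *+ 2; (l 0 0 * l 0 2) *+ 2;
           l 0 1 ^+ 2; (l 0 1 * l 0 2) *+ 2; l 0 2 ^+ 2].

Definition H1 (H : {vspace 'rV[F]_6}) : Prop :=
  exists2 l : 'rV[F]_3, l != 0 & H = zeros (double_line l).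

Definition Kact (A : 'M[F]_3) y : 'rV[F]_6 := symcoord (A *m symmx y *m A^T).

Fact Kact_is_linear A : linear (Kact A).
Proof.
move=> c y z; have symD: symmx (c *: y + z) = c *: symmx y + symmx z.
  apply/matrixP=> i j; rewrite !mxE.
  by case: i j => [[|[|[|//]]] ?] [[|[|[|//]]] ?]; rewrite /= ?mxE.
rewrite /Kact symD mulmxDr mulmxDl -scalemxAr -scalemxAl.
by apply/rowP=> -[[|[|[|[|[|[|//]]]]]] ?]; rewrite !mxE /= ?mxE.
Qed.
HB.instance Definition _ (A : 'M[F]_3) :=
  GRing.isLinear.Build F 'rV[F]_6 'rV[F]_6 _ (Kact A) (Kact_is_linear A).

Definition Korbit (U : {vspace 'rV[F]_6}) : {vspace 'rV[F]_6} -> Prop :=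
  fun W => exists2 A : 'M[F]_3, A \in unitmx & W = (linfun (Kact A) @: U)%VS.

Definition plane_Korbit (S : {vspace 'rV[F]_6} -> Prop) : Prop :=
  exists2 U : {vspace 'rV[F]_6}, \dim U = 3%N & forall W, S W <-> Korbit U W.

(* The plane of all matrices M x y z, for M linear in x, y, z. *)
Definition plane_of (M : F -> F -> F -> 'M[F]_3) : {vspace 'rV[F]_6} :=
  span [:: symcoord (M 1 0 0); symcoord (M 0 1 0); symcoord (M 0 0 1)].

Definition Sigma18_rep (c : F) := plane_of (fun x y z : F =>
  mx3 [:: [:: x;     y;     z];
          [:: y; c * z; x + z];
          [:: z; x + z;     0]]).

Definition Sigma19_rep := plane_of (fun x y z : F =>
  mx3 [:: [:: x;     y; 0];
          [:: y; y + z; z];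
          [:: 0;     z; x]]).

Definition Sigma20_rep (b c : F) := plane_of (fun x y z : F =>
  mx3 [:: [:: x;               y; b * x];
          [:: y;   c * x + y + z;     z];
          [:: b * x;           z;     x]]).

End ProjectiveSpace.

Section FiniteProjectiveSpace.

Variable F : finFieldType.
Implicit Types (v P : 'rV[F]_6) (U L E H pi : {vspace 'rV[F]_6}).

Definition point v : {set 'rV[F]_6} := [set w in <[v]>%VS].

Definition points U : {set {set 'rV[F]_6}} :=
  [set point v | v : 'rV[F]_6 & (v \in U) && (v != 0)].

Definition veronese_surface : {set {set 'rV[F]_6}} :=
  [set point (veronese u) | u : 'rV[F]_3 & u != 0].

(* The conic of the Veronese surface that is the image of the line            *)
(* l_0 X_0 + l_1 X_1 + l_2 X_2 = 0 of PG(2,q).                                *)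
Definition conic (l : 'rV[F]_3) : {set {set 'rV[F]_6}} :=
  [set point (veronese u) | u : 'rV[F]_3 & (u != 0) && (u *m l^T == 0)].

Definition veronese_conic (C : {set {set 'rV[F]_6}}) : Prop :=
  exists2 l : 'rV[F]_3, l != 0 & C = conic l.

(* P is the nucleus of C: a point of the plane of C such that every line of   *)
(* that plane through P is tangent to C.                                      *)
Definition is_nucleus P (C : {set {set 'rV[F]_6}}) : Prop :=
  exists E, [/\ \dim E = 3%N, C \subset points E, P \in E, P != 0 &
    forall L, \dim L = 2%N -> P \in L -> (L <= E)%VS ->
      #|C :&: points L| = 1%N].

(* is_H_point P H : H = H(P).  The conic C is C(P). *)
Definition is_H_point P H : Prop :=
  exists C, [/\ veronese_conic C, is_nucleus P C, H1 H & C \subset points H].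

(* is_H_plane pi H : H = H(pi). *)
Definition is_H_plane pi H : Prop := H1 H /\ (pi <= H)%VS.

Definition count_points pi (Q : pred 'rV[F]_6) : nat :=
  #|[set point v | v : 'rV[F]_6 & [&& v \in pi, v != 0 & Q v]]|.

Definition OD0 pi : seq nat :=
  [:: count_points pi (fun v => \rank (symmx v) == 1%N);
      count_points pi (fun v => v \in nucleus_plane F);
      count_points pi
        (fun v => (\rank (symmx v) == 2%N) && (v \notin nucleus_plane F));
      count_points pi (fun v => \rank (symmx v) == 3%N)].

(* The trace from F to its prime field 'F_2, as a value in F. *)
Definition Tr (ch2 : 2%N \in [pchar F]) (x : F) : F :=
  galTrace 1%AS {:pPrimeCharType ch2}%AS (x : pPrimeCharType ch2).

Definition Sigma18_param (ch2 : 2%N \in [pchar F]) (c : F) : Prop :=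
  (forall x : F, ~~ root ('X^3 + 'X + c%:P) x) /\ Tr ch2 c^-1 = Tr ch2 1.

Definition Sigma20_param (ch2 : 2%N \in [pchar F]) (b c : F) : Prop :=
  b != 1 /\ Tr ch2 (c / (1 + b ^+ 2)) = 1.

End FiniteProjectiveSpace.

(* Main.v *)
Require Import Defs.
From mathcomp Require Import all_boot all_order all_fingroup all_algebra.
From mathcomp Require Import all_solvable all_field.
From mathcomp Require Import ring.

(* Write the points of PG(5,q) as symmetric matrices.  The nucleus P of the   *)
(* conic C(P) is the alternating matrix whose kernel l is the line of C(P),   *)
(* so H(P) = H(pi) says that l M l^T = 0 for every M in pi.  After moving l   *)
(* to (0,0,1), the plane pi is the space of the matrices                      *)
(*   [a,y,d; y,e,f; d,f,0]  with (d,f)^T = T (a,e)^T,                         *)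
(* and pi misses the Veronese surface iff the 2 x 2 matrix T is invertible.   *)
(* The stabiliser of l acts by T |-> B T phi(B)^-1, where phi squares the     *)
(* entries.  By Shintani descent there are as many classes as conjugacy       *)
(* classes in GL(2,2) = S_3, namely three.                                    *)
(*                                                                            *)
(* Concretely, the determinant on pi is the binary cubic form                 *)
(*   C_T(a,e) = a f^2 + e d^2,                                                *)
(* whose zeros correspond to the vectors v != 0 with T phi(v) = v.  If C_T    *)
(* has a zero then T is equivalent to [1,b;0,1], and b matters only modulo    *)
(* the index 2 subgroup {x^2 + x}.  If C_T and C_T' have no zeros, they have  *)
(* roots t, t' in the same cubic extension of F_q; since 1, t, t', tt' are    *)
(* linearly dependent over F_q, t' is the image of t under a Moebius          *)
(* transformation g over F_q, hence g carries C_T' to a multiple of C_T, and  *)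
(* the entrywise square root of g yields the equivalence of T and T'.         *)
(* Points of rank 2 outside the nucleus plane lie over the zeros of C_T, of   *)
(* which there are 3, 1 and 0 in the three cases.                             *)

Set Implicit Arguments.
Unset Strict Implicit.
Unset Printing Implicit Defensive.

Import GRing.Theory.
Local Open Scope ring_scope.

(** * Traces and the map x |-> x^2 + x in characteristic 2 *)

(** By [normal_form], every plane in question is K-equivalent to some [normal_plane T] with [T]
    invertible. The condition H(P) = H(pi) kills the last diagonal entry on pi. Since pi meets the
    nucleus plane only in P, the diagonal pair (a,e) and the coordinate y of P parametrize pi. A
    kernel vector of [T] would yield a Veronese point, because every field element is a square. By
    [frob_equiv_Korbit] it then suffices to classify [T] up to T |-> B T phi(B)^-1. If the cubic
    form of [T] has a nontrivial zero, [cubic_zero_fixed] and [frob_equiv_fixed] make [T] unipotent,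
    and [artin_schreier_index2] leaves two classes ([isotropic_classes]). If it has none,
    [anisotropic_equiv] leaves a single class. [OD0_normal] reads the distribution
    [0, 1, qn, q(q+1-n)] off the number n of projective zeros of the form. Here n = 0, 3, 1 for the
    three classes, which also separates the orbits. *)

Section Char2Eq.

Variables (F : fieldType) (ch2 : 2%N \in [pchar F]).

(* Reduces an identity in characteristic 2 to one that [ring] proves over the *)
(* integers: z is half of the difference of the two sides.                    *)
Lemma eq_mod2 (z x y : F) : x = y + z *+ 2 -> x = y.
Proof. by rewrite mulr2n (addrr_pchar2 ch2) addr0. Qed.

End Char2Eq.

Arguments eq_mod2 [F] ch2 z [x y].

Section Trace.

Variables (F : finFieldType) (ch2 : 2%N \in [pchar F]).

Lemma TrD x y : Tr ch2 (x + y) = Tr ch2 x + Tr ch2 y.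
Proof.
exact: (raddfD (galTrace 1%AS {:pPrimeCharType ch2}%AS)).
Qed.

Lemma Tr_sqr x : Tr ch2 (x ^+ 2) = Tr ch2 x ^+ 2.
Proof.
transitivity (pFrobenius_aut ch2 (Tr ch2 x)); last exact: pFrobenius_autE.
rewrite (rmorph_sum (pFrobenius_aut ch2)).
apply: eq_bigr => g _; apply: etrans (rmorphXn g 2 x) _.
exact/esym/(pFrobenius_autE ch2).
Qed.

Lemma Tr_idem x : Tr ch2 x ^+ 2 = Tr ch2 x.
Proof.
pose t : pPrimeCharType ch2 := Tr ch2 x.
have t1 : t \in (1%AS : {subfield pPrimeCharType ch2}).
  by apply: mem_galTrace; [exact/finField_galois/sub1v | exact: memvf].
(* [1%AS] is the prime field, with 2 elements, so Fermat reads t^2 = t. *)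
have := Fermat's_little_theorem 1%AS t.
by rewrite t1 dimv1 expn1 card_Fp // => /esym/eqP.
Qed.

Lemma Tr_eq01 x : Tr ch2 x = 0 \/ Tr ch2 x = 1.
Proof.
have /eqP := Tr_idem x.
rewrite -subr_eq0 expr2 -{3}[Tr ch2 x]mulr1 -mulrBr mulf_eq0 subr_eq0.
by case/orP=> /eqP; [left | right].
Qed.

(** Dedekind independence of the automorphisms, with all coefficients 1, gives an element of nonzero
    trace. *)
Lemma Tr_surj : exists x, Tr ch2 x = 1.
Proof.
have [a _ nz] := @gal_independent_contra _ (pPrimeCharType ch2)
  {:pPrimeCharType ch2}%AS
  [in 'Gal({:pPrimeCharType ch2} / 1%AS)%g] (fun=> 1) 1%g (group1 _)
  (oner_neq0 _).
exists a; case: (Tr_eq01 a) => // tr0; case/eqP: nz; rewrite -[RHS]tr0.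
by apply: eq_bigr => g _; rewrite mul1r.
Qed.

Lemma Tr_sqrD x : Tr ch2 (x ^+ 2 + x) = 0.
Proof. by rewrite TrD Tr_sqr Tr_idem (addrr_pchar2 ch2). Qed.

(** Partial fractions: x^3 + x = x (x+1)^2, and 1/(x (x+1)^2) = 1/x + 1/(x+1) + 1/(x+1)^2, where the
    last two terms form u^2 + u and have trace 0. *)
Lemma Tr_invX3DX x : x != 0 -> x != 1 -> Tr ch2 (x ^+ 3 + x)^-1 = Tr ch2 x^-1.
Proof.
move=> x0 x1; have x10 : x + 1 != 0 by rewrite addr_eq0 (oppr_pchar2 ch2).
have -> : (x ^+ 3 + x)^-1 = x^-1 + ((x + 1)^-1 ^+ 2 + (x + 1)^-1).
  have -> : x ^+ 3 + x = x * (x + 1) ^+ 2 by apply: (eq_mod2 ch2 (- x ^+ 2));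
    ring.
  apply: (eq_mod2 ch2 (- (x ^+ 2 + x *+ 2) / (x * (x + 1) ^+ 2))); field.
  by rewrite x0 x10.
by rewrite TrD Tr_sqrD addr0.
Qed.

(* The map x |-> x^3 + x sends A = {c != 0 : Tr (1/c) = Tr 1} minus {1} into  *)
(* A, so it misses some c in A; a root of X^3 + X + c would again lie in A    *)
(* minus {1}.                                                                 *)
Lemma Sigma18_param_exists : exists c, Sigma18_param ch2 c.
Proof.
pose A := [set c : F | (c != 0) && (Tr ch2 c^-1 == Tr ch2 1)].
have A1 : 1 \in A by rewrite inE oner_neq0 invr1 eqxx.
pose g (x : F) := x ^+ 3 + x.
have [c Ac cNg] : exists2 c, c \in A & c \notin g @: (A :\ 1).
  apply/subsetPn/negP => /subset_leq_card.
  rewrite leqNgt => /negP; apply.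
  by apply: leq_ltn_trans (leq_imset_card _ _) _; rewrite (cardsD1 1 A) A1.
move: Ac; rewrite inE => /andP[c0 /eqP trc]; exists c; split=> // x.
apply: contra cNg => /rootP; rewrite !hornerE => rx.
have gx : g x = c.
  by apply/eqP; rewrite -subr_eq0 (oppr_pchar2 ch2) /g; apply/eqP.
have x0 : x != 0 by apply: contraNneq c0 => x0; rewrite -gx /g x0; apply/eqP;
  ring.
have x1 : x != 1.
  apply: contraNneq c0 => x1; rewrite -gx /g x1; apply/eqP.
  by apply: (eq_mod2 ch2 1); ring.
apply/imsetP; exists x => //.
by rewrite !inE x0 x1 -Tr_invX3DX //= -/(g x) gx trc.
Qed.

Lemma Tr1_not_artin_schreier c x : Tr ch2 c = 1 -> x ^+ 2 + x != c.
Proof.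
by move=> tr1; apply/eqP=> e; move: tr1; rewrite -e Tr_sqrD => /eqP;
  rewrite eq_sym oner_eq0.
Qed.

(** The map x |-> x^2 + x is additive with fibres {y, y+1}, so its image S has index 2: S and b + S
    fill the field, and b' must lie in b + S. *)
Lemma artin_schreier_index2 (b b' : F) : (forall x, x ^+ 2 + x != b) ->
  (forall x, x ^+ 2 + x != b') -> exists x, x ^+ 2 + x = b + b'.
Proof.
move=> Nb Nb'.
pose g (x : F) := x ^+ 2 + x; pose S := g @: setT.
have gD x y : g (x + y) = g x + g y by apply: (eq_mod2 ch2 (x * y));
  rewrite /g; ring.
have ker x y : (g x == g y) = (x \in [set y; y + 1]).
  rewrite -subr_eq0 (oppr_pchar2 ch2) -gD.
  have -> : g (x + y) = (x + y) * (x + y + 1) by rewrite /g; ring.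
  rewrite mulf_eq0 -{1}(oppr_pchar2 ch2 y) subr_eq0 -addrA.
  by rewrite -{1}(oppr_pchar2 ch2 (y + 1)) subr_eq0 !inE.
have cardS : #|F| = (#|S| * 2)%N.
  rewrite -cardsT -sum1_card (partition_big_imset g) /=.
  rewrite -sum_nat_const; apply: eq_bigr => z /imsetP[y _ ->].
  rewrite sum1dep_card.
  have <- : #|[set y; y + 1]| = 2%N.
    by rewrite cards2 eq_sym -subr_eq0 addrAC subrr add0r oner_neq0.
  by apply: eq_card => x; rewrite inE /= in_setT ker.
have inS z : z \in S -> exists x, g x = z by case/imsetP=> x _ ->; exists x.
have NSb : b \notin S by apply/negP => /inS[x]; apply/eqP/Nb.
have NSb' : b' \notin S by apply/negP => /inS[x]; apply/eqP/Nb'.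
pose bS := [set b + z | z in S].
have cardbS : #|bS| = #|S| by apply: card_imset => u v /addrI.
have dis : [disjoint S & bS].
  rewrite disjoint_sym; apply/pred0P=> z /=; apply/negP.
  case/andP=> /imsetP[_ /inS[v <-] ->] /inS[w]; rewrite -/(g v) => e.
  case/negP: (Nb (w + v)); rewrite -/(g _) gD e.
  by rewrite -addrA (addrr_pchar2 ch2) addr0.
have cov : S :|: bS = setT.
  apply/eqP; rewrite eqEcard subsetT cardsT cardsU (disjoint_setI0 dis).
  by rewrite cards0 subn0 cardbS cardS muln2 addnn leqnn.
have: b' \in S :|: bS by rewrite cov inE.
rewrite inE (negPf NSb') /= => /imsetP[_ /inS[v <-] ->]; exists v.
by rewrite addrA (addrr_pchar2 ch2) add0r.
Qed.

End Trace.

(** * Symmetric matrices and the action of K *)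

Section Coordinates.

Variable F : fieldType.
Implicit Types (y : 'rV[F]_6) (u l : 'rV[F]_3) (A B M : 'M[F]_3).
Implicit Types (U V W : {vspace 'rV[F]_6}).

Lemma forall_I2 (P : 'I_2 -> Prop) : P 0 -> P 1 -> forall i, P i.
Proof.
move=> P0 P1 [[|[|//]] lti].
- by have -> : Ordinal lti = 0 by apply: val_inj.
- by have -> : Ordinal lti = 1 by apply: val_inj.
Qed.

Lemma forall_I3 (P : 'I_3 -> Prop) : P 0 -> P 1 -> P 2 -> forall i, P i.
Proof.
move=> P0 P1 P2 [[|[|[|//]]] lti].
- by have -> : Ordinal lti = 0 by apply: val_inj.
- by have -> : Ordinal lti = 1 by apply: val_inj.
- by have -> : Ordinal lti = 2 by apply: val_inj.
Qed.

Lemma forall_I4 (P : 'I_4 -> Prop) :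
  P 0 -> P 1 -> P 2 -> P 3 -> forall i, P i.
Proof.
move=> P0 P1 P2 P3 [[|[|[|[|//]]]] lti].
- by have -> : Ordinal lti = 0 by apply: val_inj.
- by have -> : Ordinal lti = 1 by apply: val_inj.
- by have -> : Ordinal lti = 2 by apply: val_inj.
- by have -> : Ordinal lti = 3 by apply: val_inj.
Qed.

Lemma forall_I6 (P : 'I_6 -> Prop) :
  P 0 -> P 1 -> P 2 -> P 3 -> P 4 -> P 5 -> forall i, P i.
Proof.
move=> P0 P1 P2 P3 P4 P5 [[|[|[|[|[|[|//]]]]]] lti].
- by have -> : Ordinal lti = 0 by apply: val_inj.
- by have -> : Ordinal lti = 1 by apply: val_inj.
- by have -> : Ordinal lti = 2 by apply: val_inj.
- by have -> : Ordinal lti = 3 by apply: val_inj.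
- by have -> : Ordinal lti = 4 by apply: val_inj.
- by have -> : Ordinal lti = 5 by apply: val_inj.
Qed.

Lemma sum_I2 (V : nmodType) (f : 'I_2 -> V) : \sum_i f i = f 0 + f 1.
Proof.
by rewrite !big_ord_recr big_ord0 /= add0r; congr (f _ + f _); apply: val_inj.
Qed.

Lemma sum_I3 (V : nmodType) (f : 'I_3 -> V) : \sum_i f i = f 0 + f 1 + f 2.
Proof.
rewrite !big_ord_recr big_ord0 /= add0r.
by congr (f _ + f _ + f _); apply: val_inj.
Qed.

Lemma sum_I4 (V : nmodType) (f : 'I_4 -> V) :
  \sum_i f i = f 0 + f 1 + f 2 + f 3.
Proof.
rewrite !big_ord_recr big_ord0 /= add0r.
by congr (f _ + f _ + f _ + f _); apply: val_inj.
Qed.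

Lemma sum_I6 (V : nmodType) (f : 'I_6 -> V) :
  \sum_i f i = f 0 + f 1 + f 2 + f 3 + f 4 + f 5.
Proof.
rewrite !big_ord_recr big_ord0 /= add0r.
by congr (f _ + f _ + f _ + f _ + f _ + f _); apply: val_inj.
Qed.

Lemma mx3E (a b c d e f g h i : F)
    (M := mx3 [:: [:: a; b; c]; [:: d; e; f]; [:: g; h; i]]) :
  (M 0 0 = a) * (M 0 1 = b) * (M 0 2 = c) *
  ((M 1 0 = d) * (M 1 1 = e) * (M 1 2 = f)) *
  ((M 2 0 = g) * (M 2 1 = h) * (M 2 2 = i)).
Proof. by rewrite /M !mxE. Qed.

Lemma symmxE y (M := symmx y) :
  (M 0 0 = y 0 0) * (M 0 1 = y 0 1) * (M 0 2 = y 0 2) *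
  ((M 1 0 = y 0 1) * (M 1 1 = y 0 3) * (M 1 2 = y 0 4)) *
  ((M 2 0 = y 0 2) * (M 2 1 = y 0 4) * (M 2 2 = y 0 5)).
Proof. by rewrite /M !mx3E. Qed.

Lemma symmx_tr y : (symmx y)^T = symmx y.
Proof. by apply/matrixP; do 2!elim/forall_I3; rewrite !mxE. Qed.

Lemma symmxK : cancel (@symmx F) (@symcoord F).
Proof. by move=> y; apply/rowP; elim/forall_I6; rewrite !mxE. Qed.

Lemma symcoordK M : M^T = M -> symmx (symcoord M) = M.
Proof.
move=> /matrixP symM; have e i j : M i j = M j i by rewrite -[LHS]symM mxE.
by apply/matrixP; do 2!elim/forall_I3; rewrite !mxE //= e.
Qed.

Lemma symmx_veronese u : symmx (veronese u) = u^T *m u.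
Proof.
by apply/matrixP; do 2!elim/forall_I3; rewrite !mxE /= ?big_ord1 !mxE //= mulrC.
Qed.

Lemma symmx_inj : injective (@symmx F).
Proof. exact: can_inj symmxK. Qed.

Lemma symmx_Kact A y : symmx (Kact A y) = A *m symmx y *m A^T.
Proof. by rewrite symcoordK // !trmx_mul trmxK symmx_tr mulmxA. Qed.

Lemma Kact_mul A B y : Kact (A *m B) y = Kact A (Kact B y).
Proof. by rewrite {2}/Kact symmx_Kact /Kact trmx_mul !mulmxA. Qed.

Lemma Kact1 y : Kact 1%:M y = y.
Proof. by rewrite /Kact mul1mx trmx1 mulmx1 symmxK. Qed.

Lemma KactK A : A \in unitmx -> cancel (Kact A) (Kact (invmx A)).
Proof. by move=> uA y; rewrite -Kact_mul mulVmx ?Kact1. Qed.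

Lemma KactVK A : A \in unitmx -> cancel (Kact (invmx A)) (Kact A).
Proof. by move=> uA y; rewrite -Kact_mul mulmxV ?Kact1. Qed.

Lemma Kact_veronese A u : Kact A (veronese u) = veronese (u *m A^T).
Proof.
apply: symmx_inj.
by rewrite symmx_Kact !symmx_veronese trmx_mul trmxK !mulmxA.
Qed.

Lemma mem_Kimg A U y : A \in unitmx ->
  (y \in (linfun (Kact A) @: U)%VS) = (Kact (invmx A) y \in U).
Proof.
move=> uA; apply/memv_imgP/idP => [[x Ux ->] | Uy].
  by rewrite lfunE /= KactK.
by exists (Kact (invmx A) y); rewrite // lfunE /= KactVK.
Qed.

Lemma Korbit_sym U W : Korbit U W -> Korbit W U.
Proof.
case=> A uA ->; exists (invmx A); rewrite ?unitmx_inv //.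
by apply/vspaceP=> y; rewrite !mem_Kimg ?unitmx_inv // invmxK KactK.
Qed.

Lemma Korbit_trans U V W : Korbit U V -> Korbit V W -> Korbit U W.
Proof.
case=> A uA -> [B uB ->]; exists (B *m A); first by rewrite unitmx_mul uB.
apply/vspaceP=> y; rewrite !mem_Kimg ?unitmx_mul ?uA ?uB //.
rewrite -Kact_mul; congr (Kact _ y \in U).
have uBA : B *m A \in unitmx by rewrite unitmx_mul uB.
apply: (can_inj (mulKmx uBA)); rewrite mulmxV //.
by rewrite mulmxA -(mulmxA B) mulmxV // mulmx1 mulmxV.
Qed.

Lemma Kact_inj A : A \in unitmx -> injective (Kact A).
Proof. by move=> uA; apply: can_inj (KactK uA). Qed.

Lemma dim_Kimg A U : A \in unitmx -> \dim (linfun (Kact A) @: U) = \dim U.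
Proof.
move=> uA; apply: limg_dim_eq; apply/eqP; rewrite -subv0.
apply/subvP=> y; rewrite memv_cap memv_ker lfunE /= => /andP[_ /eqP].
by rewrite -(linear0 (Kact A)) => /(Kact_inj uA)->; rewrite mem0v.
Qed.

Lemma Korbit_incl A U W : A \in unitmx -> (\dim W <= \dim U)%N ->
  (forall y, y \in U -> Kact A y \in W) -> Korbit U W.
Proof.
move=> uA dimUW sUW; exists A => //; apply/esym/eqP.
rewrite eqEdim dim_Kimg // dimUW andbT; apply/subvP=> _ /memv_imgP[x Ux ->].
by rewrite lfunE sUW.
Qed.

Lemma mem_zeros (a y : 'rV[F]_6) : (y \in zeros a) = (y *m a^T == 0).
Proof. by rewrite memv_ker lfunE. Qed.

Lemma mem_nucleus y :
  (y \in nucleus_plane F) = [&& y 0 0 == 0, y 0 3 == 0 & y 0 5 == 0].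
Proof.
have coord k : (y \in zeros (delta_mx 0 k)) = (y 0 k == 0).
  rewrite mem_zeros trmx_delta -colE; apply/eqP/eqP=> [/matrixP/(_ 0 0) | y0].
    by rewrite !mxE.
  by apply/matrixP=> i j; rewrite !ord1 !mxE.
by rewrite /nucleus_plane !memv_cap !coord andbA.
Qed.

End Coordinates.

Section Char2.

Variables (F : fieldType) (ch2 : 2%N \in [pchar F]).
Implicit Types (y : 'rV[F]_6) (l : 'rV[F]_3).

Lemma mem_double_line l y : (y \in zeros (double_line l)) =
  (l 0 0 ^+ 2 * y 0 0 + l 0 1 ^+ 2 * y 0 3 + l 0 2 ^+ 2 * y 0 5 == 0).
Proof.
rewrite mem_zeros; apply/eqP/eqP=> [/matrixP/(_ 0 0) | e].
  rewrite !mxE sum_I6 !mxE /= !mulr2n !(addrr_pchar2 ch2) !mulr0 !addr0.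
  by rewrite ![_ * y _ _]mulrC.
apply/matrixP=> i j; rewrite !ord1 !mxE sum_I6 !mxE /=.
rewrite !mulr2n !(addrr_pchar2 ch2) !mulr0 !addr0 -[RHS]e.
by rewrite ![_ * y _ _]mulrC.
Qed.

(** In characteristic 2 the cross terms of l M l^T cancel in pairs, leaving only the squares of [l]
    against the diagonal. In this form the action of K on double lines is visible. *)
Lemma double_line_form l y :
  (y \in zeros (double_line l)) = (l *m symmx y *m l^T == 0).
Proof.
have -> : l *m symmx y *m l^T =
  (l 0 0 ^+ 2 * y 0 0 + l 0 1 ^+ 2 * y 0 3 + l 0 2 ^+ 2 * y 0 5)%:M.
  apply/matrixP=> i j; rewrite !ord1 [RHS]mxE /= mulr1n.
  rewrite !mxE !sum_I3 !mxE !sum_I3 !mxE /=.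
  apply: (eq_mod2 ch2 (l 0 0 * l 0 1 * y 0 1 + l 0 0 * l 0 2 * y 0 2
    + l 0 1 * l 0 2 * y 0 4)); ring.
rewrite mem_double_line; apply/eqP/eqP=> [-> | /matrixP/(_ 0 0)].
  by rewrite raddf0.
by rewrite !mxE /= mulr1n.
Qed.

(** Off-diagonal entries of a symmetric matrix contribute twice. Hence the diagonal transforms on
    its own, through the squared entries of [A]; this is the origin of the Frobenius twist. *)
Lemma Kact_diag (A : 'M[F]_3) y k : symmx (Kact A y) k k =
  A k 0 ^+ 2 * y 0 0 + A k 1 ^+ 2 * y 0 3 + A k 2 ^+ 2 * y 0 5.
Proof.
rewrite symmx_Kact !mxE !sum_I3 !mxE !sum_I3 !mxE /=.
apply: (eq_mod2 ch2 (A k 0 * A k 1 * y 0 1 + A k 0 * A k 2 * y 0 2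
  + A k 1 * A k 2 * y 0 4)); ring.
Qed.

Lemma Kact_nucleus (A : 'M[F]_3) y : A \in unitmx ->
  (Kact A y \in nucleus_plane F) = (y \in nucleus_plane F).
Proof.
have sub B x : x \in nucleus_plane F -> Kact B x \in nucleus_plane F.
  rewrite !mem_nucleus => /and3P[/eqP x0 /eqP x3 /eqP x5].
  have d k : symmx (Kact B x) k k = 0 by rewrite Kact_diag x0 x3 x5 !mulr0
    !addr0.
  by have := (d 0, d 1, d 2); rewrite !mxE /= => -[[-> ->] ->]; rewrite eqxx.
by move=> uA; apply/idP/idP=> [/(sub (invmx A)) | /sub //]; rewrite KactK.
Qed.

End Char2.

(** * The planes attached to 2 x 2 matrices *)

Section NormalForm.

Variable F : fieldType.
Implicit Types (T B : 'M[F]_2).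

Definition normal_plane T : {vspace 'rV[F]_6} := plane_of (fun a y e : F =>
  mx3 [:: [:: a; y; T 0 0 * a + T 0 1 * e];
          [:: y; e; T 1 0 * a + T 1 1 * e];
          [:: T 0 0 * a + T 0 1 * e; T 1 0 * a + T 1 1 * e; 0]]).

Definition normal_vec T (a y e : F) : 'rV[F]_6 :=
  row6 [:: a; y; T 0 0 * a + T 0 1 * e; e; T 1 0 * a + T 1 1 * e; 0].

Lemma row6E (a0 a1 a2 a3 a4 a5 : F) (v := row6 [:: a0; a1; a2; a3; a4; a5]) :
  (v 0 0 = a0) * (v 0 1 = a1) * (v 0 2 = a2) *
  (v 0 3 = a3) * (v 0 4 = a4) * (v 0 5 = a5).
Proof. by rewrite /v !mxE. Qed.

Lemma row6_eta (v : 'rV[F]_6) :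
  v = row6 [:: v 0 0; v 0 1; v 0 2; v 0 3; v 0 4; v 0 5].
Proof. by apply/rowP; elim/forall_I6; rewrite mxE. Qed.

Lemma symcoord_mx3 (a b c d e f g h i : F) :
  symcoord (mx3 [:: [:: a; b; c]; [:: d; e; f]; [:: g; h; i]])
  = row6 [:: a; b; c; e; f; i].
Proof. by rewrite /symcoord !mxE. Qed.

Lemma add_row6 (a0 a1 a2 a3 a4 a5 b0 b1 b2 b3 b4 b5 : F) :
  row6 [:: a0; a1; a2; a3; a4; a5] + row6 [:: b0; b1; b2; b3; b4; b5]
  = row6 [:: a0 + b0; a1 + b1; a2 + b2; a3 + b3; a4 + b4; a5 + b5].
Proof. by apply/rowP; elim/forall_I6; rewrite !mxE. Qed.

Lemma scale_row6 (c a0 a1 a2 a3 a4 a5 : F) :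
  c *: row6 [:: a0; a1; a2; a3; a4; a5]
  = row6 [:: c * a0; c * a1; c * a2; c * a3; c * a4; c * a5].
Proof. by apply/rowP; elim/forall_I6; rewrite !mxE. Qed.

Lemma mem_plane_of (M : F -> F -> F -> 'M[F]_3) v :
  reflect (exists x y z, v = x *: symcoord (M 1 0 0) + y *: symcoord (M 0 1 0)
                           + z *: symcoord (M 0 0 1))
    (v \in plane_of M).
Proof.
rewrite /plane_of !span_cons span_nil addv0; apply: (iffP idP).
  case/memv_addP=> v1 /vlineP[x ->] [v' /memv_addP[v2 /vlineP[y ->]]].
  by case=> v3 /vlineP[z ->] -> ->; exists x, y, z; rewrite addrA.
case=> x [y [z ->]]; rewrite -addrA.
by rewrite !memv_add ?memvZ ?memv_line.
Qed.

Lemma dim_plane_of M : (\dim (@plane_of F M) <= 3)%N.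
Proof. exact: dim_span. Qed.

Lemma mem_normal T v : (v \in normal_plane T) =
  [&& v 0 2 == T 0 0 * v 0 0 + T 0 1 * v 0 3,
      v 0 4 == T 1 0 * v 0 0 + T 1 1 * v 0 3 & v 0 5 == 0].
Proof.
apply/mem_plane_of/and3P=> [[x [y [z ->]]] | [/eqP v2 /eqP v4 /eqP v5]].
  by rewrite /= !symcoord_mx3 !scale_row6 !add_row6 ?row6E; split; apply/eqP;
    ring.
exists (v 0 0), (v 0 1), (v 0 3).
by rewrite [LHS]row6_eta /= !symcoord_mx3 !scale_row6 !add_row6 ?row6E v2 v4
  v5; congr row6; congr [:: _; _; _; _; _; _]; ring.
Qed.

Lemma normal_planeP T v :
  reflect (exists a y e, v = normal_vec T a y e) (v \in normal_plane T).
Proof.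
rewrite mem_normal; apply: (iffP and3P)=> [[/eqP v2 /eqP v4 /eqP v5] | ].
  exists (v 0 0), (v 0 1), (v 0 3).
  by rewrite /normal_vec [LHS]row6_eta v2 v4 v5.
by case=> a [y [e ->]]; rewrite /normal_vec !row6E.
Qed.

Lemma normal_vec_inj T a y e a' y' e' :
  normal_vec T a y e = normal_vec T a' y' e' -> [/\ a = a', y = y' & e = e'].
Proof.
move=> /rowP eqv; have := (eqv 0, eqv 1, eqv 3).
by rewrite !row6E => -[[-> ->] ->].
Qed.

Lemma dim_normal T : \dim (normal_plane T) = 3%N.
Proof.
(* For a span of three vectors, having dimension 3 is by definition freeness. *)
apply/eqP; rewrite -[_ == _]/(free _) -[X in free X]/(val [tuple _; _; _]).
apply/freeP=> k; rewrite sum_I3 /= !symcoord_mx3 !scale_row6 !add_row6 => /rowP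
  k0.
have := (k0 0, k0 1, k0 3); rewrite !row6E !mxE.
rewrite !mulr0 !mulr1 !addr0 !add0r => -[[k00 k01] k02].
by elim/forall_I3.
Qed.

End NormalForm.

(** * Twisted equivalence of 2 x 2 matrices and K-equivalence of planes *)

Section Equivalence.

Variables (F : fieldType) (ch2 : 2%N \in [pchar F]).
Implicit Types (T B : 'M[F]_2).

Local Notation phi := (map_mx (pFrobenius_aut ch2)).

Definition frob_equiv T T' :=
  exists2 B, B \in unitmx & B *m T = T' *m phi B.

Lemma frob_equiv_sym T T' : frob_equiv T T' -> frob_equiv T' T.
Proof.
case=> B uB e; exists (invmx B); rewrite ?unitmx_inv //.
rewrite map_invmx; apply: (canRL (mulmxK _)); rewrite ?map_unitmx //.
by rewrite -mulmxA -e mulKmx.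
Qed.

Lemma frob_equiv_trans T1 T2 T3 :
  frob_equiv T1 T2 -> frob_equiv T2 T3 -> frob_equiv T1 T3.
Proof.
case=> B uB e [C uC e']; exists (C *m B); first by rewrite unitmx_mul uC.
by rewrite -mulmxA e mulmxA e' map_mxM mulmxA.
Qed.

Definition embed B : 'M[F]_3 :=
  mx3 [:: [:: B 0 0; B 0 1; 0]; [:: B 1 0; B 1 1; 0]; [:: 0; 0; 1]].

Lemma embed_unit B : B \in unitmx -> embed B \in unitmx.
Proof.
move=> uB; suff: embed B *m embed (invmx B) = 1%:M by case/mulmx1_unit.
have /matrixP e : B *m invmx B = 1%:M by rewrite mulmxV.
have := (e 0 0, e 0 1, e 1 0, e 1 1); rewrite !mxE !sum_I2 /=.
move=> -[[[e00 e01] e10] e11].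
by apply/matrixP; do 2!elim/forall_I3; rewrite !mxE sum_I3 !mxE /=;
  rewrite ?mulr0 ?mul0r ?mulr1 ?addr0 ?add0r.
Qed.

(** Under [embed B] the diagonal pair (a,e) is multiplied by phi(B) and the last column (d,f) by B.
    The relation (d,f) = T (a,e) thus becomes the one for T' as soon as B T = T' phi(B). *)
Lemma frob_equiv_Korbit T T' :
  frob_equiv T T' -> Korbit (normal_plane T) (normal_plane T').
Proof.
case=> B uB /matrixP e.
have := (e 0 0, e 0 1, e 1 0, e 1 1).
rewrite !mxE !sum_I2 !mxE !pFrobenius_autE => -[[[e00 e01] e10] e11].
apply: (Korbit_incl (embed_unit uB)); first by rewrite !dim_normal.
move=> _ /normal_planeP[a [y [d ->]]]; rewrite mem_normal.
set v := Kact _ _.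
have vE i j : symmx v i j = (embed B *m symmx (normal_vec T a y d)
    *m (embed B)^T) i j by rewrite symmx_Kact.
have vd k : symmx v k k = embed B k 0 ^+ 2 * normal_vec T a y d 0 0
    + embed B k 1 ^+ 2 * normal_vec T a y d 0 3
    + embed B k 2 ^+ 2 * normal_vec T a y d 0 5 by exact: Kact_diag.
clearbody v.
have v0 : v 0 0 = B 0 0 ^+ 2 * a + B 0 1 ^+ 2 * d.
  have := vd 0; rewrite symmxE => ->.
  by rewrite !mx3E !row6E; ring.
have v3 : v 0 3 = B 1 0 ^+ 2 * a + B 1 1 ^+ 2 * d.
  have := vd 1; rewrite symmxE => ->.
  by rewrite !mx3E !row6E; ring.
have v5 : v 0 5 = 0.
  have := vd 2; rewrite symmxE => ->.
  by rewrite !mx3E !row6E; ring.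
have v2 : v 0 2 = B 0 0 * (T 0 0 * a + T 0 1 * d)
                + B 0 1 * (T 1 0 * a + T 1 1 * d).
  have := vE 0 2; rewrite symmxE mxE sum_I3 !mxE !sum_I3 => ->.
  by rewrite ?mx3E ?mxE /= ?row6E; ring.
have v4 : v 0 4 = B 1 0 * (T 0 0 * a + T 0 1 * d)
                + B 1 1 * (T 1 0 * a + T 1 1 * d).
  have := vE 1 2; rewrite symmxE mxE sum_I3 !mxE !sum_I3 => ->.
  by rewrite ?mx3E ?mxE /= ?row6E; ring.
rewrite v0 v2 v3 v4 v5 eqxx andbT.
apply/andP; split; apply/eqP.
  transitivity ((B 0 0 * T 0 0 + B 0 1 * T 1 0) * a +
                (B 0 0 * T 0 1 + B 0 1 * T 1 1) * d); first by ring.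
  by rewrite e00 e01; ring.
transitivity ((B 1 0 * T 0 0 + B 1 1 * T 1 0) * a +
              (B 1 0 * T 0 1 + B 1 1 * T 1 1) * d); first by ring.
by rewrite e10 e11; ring.
Qed.

Definition mx2 (a b c d : F) : 'M[F]_2 :=
  \matrix_(i, j) nth 0 (nth [::] [:: [:: a; b]; [:: c; d]] i) j.

Lemma Sigma18_normal c : c != 0 ->
  Korbit (normal_plane (mx2 0 c^-1 1 c^-1)) (Sigma18_rep c).
Proof.
move=> c0; apply: (Korbit_incl (unitmx1 _ _)).
  by rewrite dim_normal dim_plane_of.
move=> _ /normal_planeP[a [y [e ->]]]; rewrite Kact1; apply/mem_plane_of.
exists a, y, (c^-1 * e);
  rewrite /= !symcoord_mx3 !scale_row6 !add_row6 /normal_vec !mxE /=.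
by congr row6; congr [:: _; _; _; _; _; _]; field.
Qed.

(* Moves the kernel (1,0,1) of the nucleus point of the representatives of     *)
(* Sigma_19 and Sigma_20 to (0,0,1).                                          *)
Definition shear : 'M[F]_3 :=
  mx3 [:: [:: 1; 0; 0]; [:: 0; 1; 0]; [:: 1; 0; 1]].

Lemma shear_unit : shear \in unitmx.
Proof.
suff: shear *m shear = 1%:M by case/mulmx1_unit.
have e : 1 + 1 = 0 :> F by rewrite (addrr_pchar2 ch2).
by apply/matrixP; do 2!elim/forall_I3; rewrite !mxE sum_I3 !mxE /=;
  rewrite ?mulr0 ?mul0r ?mulr1 ?addr0 ?add0r.
Qed.

Lemma Kact_shear y : Kact shear y =
  row6 [:: y 0 0; y 0 1; y 0 0 + y 0 2; y 0 3; y 0 1 + y 0 4; y 0 0 + y 0 5].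
Proof.
have mulS (M : 'M[F]_3) i j : (shear *m M) i j =
    if i == 2 then M 0 j + M 2 j else M i j.
  move: i; elim/forall_I3; rewrite !mxE sum_I3 !mxE /=; by ring.
have mulST (M : 'M[F]_3) i j : (M *m shear^T) i j =
    if j == 2 then M i 0 + M i 2 else M i j.
  by rewrite -[M *m _]trmxK trmx_mul trmxK mxE mulS !mxE.
apply/rowP; elim/forall_I6;
  rewrite /Kact [LHS]mxE /= !(mulST, mulS) /= !mxE //=.
by apply: (eq_mod2 ch2 (y 0 2)); ring.
Qed.

Lemma Sigma20_normal b c :
  Korbit (normal_plane (mx2 (1 + b) 0 c 1)) (Sigma20_rep b c).
Proof.
apply: (Korbit_incl shear_unit); first by rewrite dim_normal dim_plane_of.
move=> _ /normal_planeP[a [y [e ->]]]; apply/mem_plane_of.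
(* The shear fixes the diagonal entry e, which must equal c x + y + z with x = a; this determines
   z. *)
exists a, y, (e + c * a + y);
  rewrite Kact_shear /= !symcoord_mx3 !scale_row6 !add_row6 !mxE /=.
congr row6; congr [:: _; _; _; _; _; _].
- by ring.
- by ring.
- by apply: (eq_mod2 ch2 a); ring.
- by apply: (eq_mod2 ch2 (- (c * a + y))); ring.
- by ring.
- by ring.
Qed.

Lemma Sigma19_normal : Korbit (normal_plane 1%:M) (Sigma19_rep F).
Proof.
apply: (Korbit_incl shear_unit); first by rewrite dim_normal dim_plane_of.
move=> _ /normal_planeP[a [y [e ->]]]; apply/mem_plane_of.
exists a, y, (e + y);
  rewrite Kact_shear /= !symcoord_mx3 !scale_row6 !add_row6 !mxE /=.
congr row6; congr [:: _; _; _; _; _; _].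
- by ring.
- by ring.
- by apply: (eq_mod2 ch2 a); ring.
- by apply: (eq_mod2 ch2 (- y)); ring.
- by ring.
- by ring.
Qed.

End Equivalence.

(** * Binary cubic forms *)

Section Mobius.

Lemma irreducible_dvdp_root (F : fieldType) (L : fieldExtType F) (p r : {poly
  F})
    (z : L) : irreducible_poly p ->
  root (map_poly (in_alg L) p) z -> root (map_poly (in_alg L) r) z -> p %| r.
Proof.
move=> irr_p pz rz; case: (boolP (coprimep p r)) => [|ncop].
  rewrite -(coprimep_map (in_alg L)) => /coprimep_root/(_ pz).
  by move: rz; rewrite /root => ->.
case: irr_p => p_gt1 irr_p.
have /irr_p/(_ (dvdp_gcdl p r)) : size (gcdp p r) != 1.
  by rewrite -coprimep_def.
by move/eqp_dvdl <-; apply: dvdp_gcdr.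
Qed.

Variable F : finFieldType.

(** Adjoining a root of either cubic gives a field with q^3 elements. So p' divides X^(q^3) - X,
    which splits in the extension obtained from p. *)
Lemma cubic_roots_in_cubic_extension (p p' : {poly F}) :
  size p = 4%N -> size p' = 4%N -> (forall x, ~~ root p x) ->
  (forall x, ~~ root p' x) ->
  exists (L : fieldExtType F) (t t' : L), [/\ \dim {:L} = 3%N,
    root (map_poly (in_alg L) p) t & root (map_poly (in_alg L) p') t'].
Proof.
move=> sz_p sz_p' rp rp'.
have irr_p : irreducible_poly p by apply: cubic_irreducible => //; rewrite sz_p.
have irr_p' : irreducible_poly p' by apply: cubic_irreducible => //;
  rewrite sz_p'.
have [L dimL [t pt _]] := irredp_FAdjoin irr_p.
have [L' dimL' [t' pt' _]] := irredp_FAdjoin irr_p'.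
rewrite sz_p sz_p' /= in dimL dimL'.
pose n := (#|F| ^ 3)%N.
have dvd_p' : p' %| 'X^n - 'X.
  apply: irreducible_dvdp_root irr_p' pt' _.
  rewrite rmorphB /= map_polyXn map_polyX /root !hornerE subr_eq0.
  by have := memvf t'; rewrite Fermat's_little_theorem dimL'.
pose fL : finFieldType := finvect_type L.
have card_fL : #|fL| = n.
  rewrite /n -dimL -(card_vspace (fullv : {vspace finvect_type L})).
  by apply: eq_card => x; rewrite !inE memvf.
have dvd_L : map_poly (in_alg L) p' %| \prod_(x : fL) ('X - (x : L)%:P).
  have <- : map_poly (in_alg L) ('X^n - 'X) = \prod_(x : fL) ('X - (x : L)%:P).
    by rewrite -(finField_genPoly fL) card_fL rmorphB /= map_polyXn map_polyX.
  by rewrite dvdp_map.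
have [m] := dvdp_prod_XsubC dvd_L.
case: (mask _ _) => [|t2 s].
  rewrite big_nil => /eqp_size; rewrite size_poly1.
  by rewrite size_map_poly sz_p'.
move=> eqp; exists L, t, t2; split=> //.
by rewrite (eqp_root eqp) big_cons rootM root_XsubC eqxx.
Qed.

(* Four elements 1, t, t', t t' of a cubic extension are dependent. *)
Lemma irreducible_cubics_mobius (p p' : {poly F}) :
  size p = 4%N -> size p' = 4%N -> (forall x, ~~ root p x) ->
  (forall x, ~~ root p' x) ->
  exists m0 m1 m2 m3 : F, ~ [/\ m0 = 0, m1 = 0, m2 = 0 & m3 = 0] /\
    p %| \sum_(i < 4) p'`_i *:
      ((m1 *: 'X + m0%:P) ^+ i * (m3 *: 'X + m2%:P) ^+ (3 - i)).
Proof.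
move=> sz_p sz_p' rp rp'.
have irr_p : irreducible_poly p by apply: cubic_irreducible => //; rewrite sz_p.
have [L [t [t' [dimL pt pt']]]] := cubic_roots_in_cubic_extension sz_p sz_p' rp
  rp'.
pose X : 4.-tuple L := [tuple 1; t; t'; t * t'].
have /existsP[c /andP[c0 /eqP sumc]] :
    [exists c : {ffun 'I_4 -> F}, (c != 0) && (\sum_i c i *: X`_i == 0)].
  apply: contraT => /existsPn Nc.
  have /eqP : free X.
    apply/freeP=> k sumk i; have := Nc (finfun k).
    under eq_bigr do rewrite ffunE.
    by rewrite sumk eqxx andbT negbK => /eqP/ffunP/(_ i); rewrite !ffunE.
  move=> e; have := dimvS (subvf <<X>>%VS).
  by rewrite e dimL.
(* The relation c0 + c1 t + c2 t' + c3 t t' = 0 is solved as t' (c3 t + c2) = -(c1 t + c0). The sum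
   in the goal is p' homogenized in degree 3; at t it equals (m3 t + m2)^3 p'(t') = 0. *)
exists (- c 0), (- c 1), (c 2), (c 3); split.
  case=> /eqP; rewrite oppr_eq0 => /eqP z0 /eqP;
    rewrite oppr_eq0 => /eqP z1 z2 z3.
  by case/eqP: c0; apply/ffunP; elim/forall_I4; rewrite ffunE.
apply: irreducible_dvdp_root irr_p pt _.
have {sumc} sumc : c 0 *: 1 + c 1 *: t + c 2 *: t' + c 3 *: (t * t') = 0.
  by rewrite -[RHS]sumc sum_I4.
set m0 := c _ in sumc *; set m1 := c _ in sumc *; set m2 := c _ in sumc *.
set m3 := c _ in sumc *.
have eN : (- m1)%:A * t + (- m0)%:A = t' * (m3%:A * t + m2%:A).
  have {sumc} : m0%:A + m1%:A * t + m2%:A * t' + m3%:A * (t * t') = 0.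
    by rewrite !mulr_algl.
  rewrite !scaleNr; move: m0%:A m1%:A m2%:A m3%:A => a0 a1 a2 a3 e.
  apply/eqP; rewrite -subr_eq0 -oppr_eq0 -[X in _ == X]e; apply/eqP; ring.
rewrite /root rmorph_sum horner_sum /=.
have {pt'} : \sum_(i < 4) (p'`_i)%:A * t' ^+ i = 0.
  move/rootP: pt'; rewrite horner_coef size_map_poly sz_p' => e;
    rewrite -[RHS]e.
  by apply: eq_bigr => i _; rewrite coef_map.
move=> e; apply/eqP.
transitivity ((\sum_(i < 4) (p'`_i)%:A * t' ^+ i) * (m3%:A * t + m2%:A) ^+ 3);
  last by rewrite e mul0r.
rewrite mulr_suml; apply: eq_bigr => i _.
have -> : (m3%:A * t + m2%:A) ^+ 3 =
    (m3%:A * t + m2%:A) ^+ i * (m3%:A * t + m2%:A) ^+ (3 - i).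
  by rewrite -exprD subnKC // -ltnS.
rewrite map_polyZ /= rmorphM !rmorphXn !rmorphD /= !map_polyZ /= !map_polyX
  !map_polyC /=.
rewrite !hornerE eN exprMn /=.
move: (_ ^+ i) (_ ^+ i) (_ ^+ (3 - i)) (_%:A) => u v w a; ring.
Qed.

End Mobius.

Section Unit2.

Variable F : fieldType.

Lemma mx2E (a b c d : F) (M := mx2 a b c d) :
  (M 0 0 = a) * (M 0 1 = b) * (M 1 0 = c) * (M 1 1 = d).
Proof. by rewrite /M !mxE. Qed.

Lemma mx2_eta (M : 'M[F]_2) : M = mx2 (M 0 0) (M 0 1) (M 1 0) (M 1 1).
Proof. by apply/matrixP; do 2!elim/forall_I2; rewrite mx2E. Qed.

Lemma mul_mx2 (a b c d a' b' c' d' : F) : mx2 a b c d *m mx2 a' b' c' d' =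
  mx2 (a * a' + b * c') (a * b' + b * d') (c * a' + d * c') (c * b' + d * d').
Proof.
by apply/matrixP; do 2!elim/forall_I2; rewrite mxE sum_I2 !mx2E.
Qed.

Lemma map_mx2 (f : F -> F) (a b c d : F) :
  map_mx f (mx2 a b c d) = mx2 (f a) (f b) (f c) (f d).
Proof. by apply/matrixP; do 2!elim/forall_I2; rewrite mxE !mx2E. Qed.

Lemma det_mx2 (M : 'M[F]_2) : \det M = M 0 0 * M 1 1 - M 0 1 * M 1 0.
Proof.
rewrite (expand_det_row _ 0) sum_I2 /cofactor !det_mx11 !mxE /=.
have l00 : lift (0 : 'I_2) (0 : 'I_1) = 1 by apply: val_inj.
have l10 : lift (1 : 'I_2) (0 : 'I_1) = 0 by apply: val_inj.
by rewrite l00 l10; ring.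
Qed.

Lemma det_mx3 (M : 'M[F]_3) : \det M =
  M 0 0 * (M 1 1 * M 2 2 - M 1 2 * M 2 1)
  - M 0 1 * (M 1 0 * M 2 2 - M 1 2 * M 2 0)
  + M 0 2 * (M 1 0 * M 2 1 - M 1 1 * M 2 0).
Proof.
rewrite (expand_det_row _ 0) sum_I3 /cofactor !det_mx2 !mxE /=.
have l00 : lift (0 : 'I_3) (0 : 'I_2) = 1 by apply: val_inj.
have l01 : lift (0 : 'I_3) (1 : 'I_2) = 2 by apply: val_inj.
have l10 : lift (1 : 'I_3) (0 : 'I_2) = 0 by apply: val_inj.
have l11 : lift (1 : 'I_3) (1 : 'I_2) = 2 by apply: val_inj.
have l20 : lift (2 : 'I_3) (0 : 'I_2) = 0 by apply: val_inj.
have l21 : lift (2 : 'I_3) (1 : 'I_2) = 1 by apply: val_inj.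
by rewrite l00 l01 l10 l11 l20 l21; ring.
Qed.

Lemma unitmx2 (M : 'M[F]_2) :
  (M \in unitmx) = (M 0 0 * M 1 1 - M 0 1 * M 1 0 != 0).
Proof. by rewrite unitmxE unitfE det_mx2. Qed.

Lemma unitmx2_ker (M : 'M[F]_2) a b : M \in unitmx ->
  M 0 0 * a + M 0 1 * b = 0 -> M 1 0 * a + M 1 1 * b = 0 -> a = 0 /\ b = 0.
Proof.
rewrite unitmx2 => nz e0 e1.
have da : (M 0 0 * M 1 1 - M 0 1 * M 1 0) * a = 0.
  transitivity (M 1 1 * (M 0 0 * a + M 0 1 * b)
    - M 0 1 * (M 1 0 * a + M 1 1 * b)); first by ring.
  by rewrite e0 e1; ring.
have db : (M 0 0 * M 1 1 - M 0 1 * M 1 0) * b = 0.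
  transitivity (M 0 0 * (M 1 0 * a + M 1 1 * b)
    - M 1 0 * (M 0 0 * a + M 0 1 * b)); first by ring.
  by rewrite e0 e1; ring.
by move/eqP: da; move/eqP: db; rewrite !mulf_eq0 (negPf nz) => /eqP -> /eqP ->.
Qed.

End Unit2.

(** * Classification of invertible 2 x 2 matrices by their cubic forms *)

Section Classification.

Variables (F : finFieldType) (ch2 : 2%N \in [pchar F]).
Implicit Types (T B : 'M[F]_2).

Local Notation phi := (map_mx (pFrobenius_aut ch2)).
Local Notation frob_equiv := (frob_equiv ch2).

Lemma sqr_inj : injective (fun x : F => x ^+ 2).
Proof.
move=> x y /eqP; rewrite -!(pFrobenius_autE ch2) => /eqP.
exact: (fmorph_inj (pFrobenius_aut ch2)).
Qed.

Lemma sqr_surj (x : F) : exists y, y ^+ 2 = x.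
Proof. by have [g _ gK] := injF_bij sqr_inj; exists (g x); rewrite gK. Qed.

Definition cubic T (a e : F) : F :=
  a * (T 1 0 * a + T 1 1 * e) ^+ 2 + e * (T 0 0 * a + T 0 1 * e) ^+ 2.

Definition anisotropic T := forall a e, cubic T a e = 0 -> a = 0 /\ e = 0.

(* A zero (a,e) is proportional to (d^2,f^2) with (d,f) = T (a,e); rescaling   *)
(* (d,f) turns it into a fixed vector of the semilinear map T phi.            *)
Lemma cubic_zero_fixed T a e : T \in unitmx -> cubic T a e = 0 ->
  (a != 0) || (e != 0) ->
  exists v w, [/\ (v != 0) || (w != 0), T 0 0 * v ^+ 2 + T 0 1 * w ^+ 2 = v
    & T 1 0 * v ^+ 2 + T 1 1 * w ^+ 2 = w].
Proof.
rewrite /cubic => uT; set d := T 0 0 * a + _; set f := T 1 0 * a + _ => C0 nz.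
have nz_df : (d != 0) || (f != 0).
  rewrite -negb_and; apply: contraL nz => /andP[/eqP d0 /eqP f0].
  by have [-> ->] := unitmx2_ker uT d0 f0; rewrite eqxx.
have [dE fE] : d = T 0 0 * a + T 0 1 * e /\ f = T 1 0 * a + T 1 1 * e by [].
clearbody d f; have [k k0 [ea ee]] : exists2 k, k != 0 & a = k * d ^+ 2 /\ e =
  k * f ^+ 2.
  have e1 : a * f ^+ 2 = e * d ^+ 2.
    by apply/eqP; rewrite -subr_eq0 (oppr_pchar2 ch2) C0.
  have [d0 | d0] := eqVneq d 0.
    have f0 : f != 0 by move: nz_df; rewrite d0 eqxx.
    have a0 : a = 0.
      move/eqP: e1; rewrite d0 expr0n mulr0 mulf_eq0 expf_eq0 /= (negPf f0)
        orbF.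
      by move/eqP.
    exists (e / f ^+ 2); last by rewrite d0 a0 expr0n mulr0 divfK // expf_neq0.
    by move: nz; rewrite a0 eqxx /= => nz;
      rewrite mulf_neq0 // invr_neq0 // expf_neq0.
  have d2 : d ^+ 2 != 0 by rewrite expf_neq0.
  exists (a / d ^+ 2); last by rewrite divfK // mulrAC e1 mulfK.
  rewrite mulf_neq0 ?invr_neq0 //; apply: contraTneq nz => a0.
  move/eqP: e1; rewrite a0 mul0r eq_sym mulf_eq0 (negPf d2) orbF => /eqP ->.
  by rewrite eqxx.
exists (k * d), (k * f); split.
- by rewrite !mulf_eq0 !(negPf k0).
- by rewrite [in RHS]dE ea ee; ring.
- by rewrite [in RHS]fE ea ee; ring.
Qed.

(** A fixed vector of T phi, taken as first column of B, makes (1,0) the first column of B^-1 T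
    phi(B). Conjugating by diag(1,d) then normalizes the remaining diagonal entry d to 1. *)
Lemma frob_equiv_fixed T v w : T \in unitmx -> (v != 0) || (w != 0) ->
  T 0 0 * v ^+ 2 + T 0 1 * w ^+ 2 = v -> T 1 0 * v ^+ 2 + T 1 1 * w ^+ 2 = w ->
  exists b, frob_equiv T (mx2 1 b 0 1).
Proof.
move=> uT nz fv fw.
have [B [uB B00 B10]] : exists B, [/\ B \in unitmx, B 0 0 = v & B 1 0 = w].
  have [v0 | v0] := eqVneq v 0.
    exists (mx2 v 1 w 0); rewrite unitmx2 !mx2E; split=> //.
    by move: nz; rewrite v0 eqxx /= => w0; rewrite mul1r mul0r sub0r oppr_eq0.
  exists (mx2 v 0 w 1); rewrite unitmx2 !mx2E; split=> //.
  by rewrite mulr1 mul0r subr0.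
pose T1 := invmx B *m T *m phi B.
have uT1 : T1 \in unitmx by rewrite !unitmx_mul unitmx_inv uB uT map_unitmx uB.
have eq1 : B *m T1 = T *m phi B by rewrite /T1 -mulmxA mulKVmx.
have equ1 : frob_equiv T1 T by exists B.
clearbody T1.
have [T100 T110] : T1 0 0 = 1 /\ T1 1 0 = 0.
  have col0 : col 0 T1 = col 0 1%:M.
    rewrite -[LHS](mulKmx uB) -[RHS](mulKmx uB); congr (_ *m _).
    rewrite !colE !mulmxA eq1 mulmx1 -!colE.
    apply/matrixP=> i j; rewrite !mxE sum_I2 !mxE !pFrobenius_autE B00 B10.
    by move: i; elim/forall_I2; rewrite ?fv ?fw ?B00 ?B10.
  by move/matrixP: col0 => c; have := (c 0 0, c 1 0); rewrite !mxE => -[-> ->].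
set b := T1 0 1; set d := T1 1 1.
have T1E : T1 = mx2 1 b 0 d by rewrite [LHS]mx2_eta T100 T110.
have d0 : d != 0 by move: uT1; rewrite unitmx2 T100 T110 mul1r mulr0 subr0.
exists (b / d ^+ 2); apply: frob_equiv_trans (frob_equiv_sym equ1) _.
exists (mx2 1 0 0 d); first by rewrite unitmx2 !mx2E mul1r mulr0 subr0.
rewrite T1E map_mx2 !mul_mx2 !pFrobenius_autE.
by congr mx2; field.
Qed.

Lemma frob_equiv_shift b b' x :
  x ^+ 2 + x = b + b' -> frob_equiv (mx2 1 b 0 1) (mx2 1 b' 0 1).
Proof.
move=> ex; exists (mx2 1 x 0 1).
  by rewrite unitmx2 !mx2E mulr0 subr0 mulr1 oner_neq0.
rewrite map_mx2 !mul_mx2 !pFrobenius_autE; congr mx2; try by ring.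
have {ex} -> : b = x ^+ 2 + x - b' by rewrite ex addrK.
by apply: (eq_mod2 ch2 (x - b')); ring.
Qed.

Lemma isotropic_classes T a e b0 : T \in unitmx -> cubic T a e = 0 ->
  (a != 0) || (e != 0) -> (forall x, x ^+ 2 + x != b0) ->
  frob_equiv 1%:M T \/ frob_equiv (mx2 1 b0 0 1) T.
Proof.
move=> uT C0 nz Nb0.
have [v [w [nzvw fv fw]]] := cubic_zero_fixed uT C0 nz.
have [b eqT] := frob_equiv_fixed uT nzvw fv fw.
have [/existsP[x /eqP ex] | Nb] := boolP [exists x, x ^+ 2 + x == b].
  left; apply: frob_equiv_trans (frob_equiv_sym eqT).
  have -> : 1%:M = mx2 1 0 0 1 :> 'M[F]_2.
    by apply/matrixP; do 2!elim/forall_I2; rewrite !mxE.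
  by apply: (@frob_equiv_shift _ _ x); rewrite add0r.
right; apply: frob_equiv_trans (frob_equiv_sym eqT).
have {}Nb x : x ^+ 2 + x != b by apply: contra Nb => e1; apply/existsP;
  exists x.
by have [x ex] := artin_schreier_index2 ch2 Nb0 Nb; apply: frob_equiv_shift ex.
Qed.

(** The cubic form at e = 1. Its mixed terms vanish in characteristic 2, so its coefficients are the
    squares of the entries of [T], and the form determines [T]. *)
Definition cubic_poly T : {poly F} :=
  \poly_(i < 4) nth 0 [:: T 0 1 ^+ 2; T 1 1 ^+ 2; T 0 0 ^+ 2; T 1 0 ^+ 2] i.

Lemma horner_cubic_poly T x : (cubic_poly T).[x] = cubic T x 1.
Proof.
rewrite horner_poly sum_I4 /= /cubic.
by apply: (eq_mod2 ch2 (- (T 1 0 * T 1 1 * x ^+ 2 + T 0 0 * T 0 1 * x))); ring.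
Qed.

Lemma cubic_poly_anisotropic T : anisotropic T ->
  size (cubic_poly T) = 4%N /\ forall x, ~~ root (cubic_poly T) x.
Proof.
move=> anT; split.
  rewrite size_poly_eq //= expf_neq0 //; apply: contraT;
    rewrite negbK => /eqP g0.
  have [|/eqP] := anT 1 0; last by rewrite oner_eq0.
  by rewrite /cubic g0; ring.
move=> x; apply/negP => /rootP; rewrite horner_cubic_poly => /anT[_ /eqP].
by rewrite oner_eq0.
Qed.

End Classification.

Section Classification.

Variables (F : finFieldType) (ch2 : 2%N \in [pchar F]).
Implicit Types (T B : 'M[F]_2).

(* The substitution [m1,m0;m3,m2] carries the cubic form of T' to k times that *)
(* of T; the equations compare the four coefficients modulo 2.                *)
Lemma anisotropic_mobius T T' : anisotropic T -> anisotropic T' ->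
  exists k m0 m1 m2 m3 : F, [/\ k != 0, m1 * m2 + m0 * m3 != 0 & [/\
    k * T 1 0 ^+ 2 = m1 * (T' 1 0 * m1 + T' 1 1 * m3) ^+ 2
      + m3 * (T' 0 0 * m1 + T' 0 1 * m3) ^+ 2,
    k * T 0 0 ^+ 2 = m0 * (T' 1 0 * m1 + T' 1 1 * m3) ^+ 2
      + m2 * (T' 0 0 * m1 + T' 0 1 * m3) ^+ 2,
    k * T 1 1 ^+ 2 = m1 * (T' 1 0 * m0 + T' 1 1 * m2) ^+ 2
      + m3 * (T' 0 0 * m0 + T' 0 1 * m2) ^+ 2 &
    k * T 0 1 ^+ 2 = m0 * (T' 1 0 * m0 + T' 1 1 * m2) ^+ 2
      + m2 * (T' 0 0 * m0 + T' 0 1 * m2) ^+ 2]].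
Proof.
move=> anT anT'.
have [szp rootp] := cubic_poly_anisotropic ch2 anT.
have [szp' rootp'] := cubic_poly_anisotropic ch2 anT'.
have [m0 [m1 [m2 [m3 [nz dvd_p]]]]] :=
  irreducible_cubics_mobius szp szp' rootp rootp'.
pose c3 := T' 1 0 ^+ 2; pose c2 := T' 0 0 ^+ 2.
pose c1 := T' 1 1 ^+ 2; pose c0 := T' 0 1 ^+ 2.
pose r3 := c3 * m1 ^+ 3 + c2 * m1 ^+ 2 * m3 + c1 * m1 * m3 ^+ 2 + c0 * m3 ^+ 3.
pose r2 := c3 * m1 ^+ 2 * m0 *+ 3 + c2 * (m1 ^+ 2 * m2 + m1 * m0 * m3 *+ 2)
  + c1 * (m1 * m3 * m2 *+ 2 + m0 * m3 ^+ 2) + c0 * m3 ^+ 2 * m2 *+ 3.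
pose r1 := c3 * m1 * m0 ^+ 2 *+ 3 + c2 * (m0 ^+ 2 * m3 + m1 * m0 * m2 *+ 2)
  + c1 * (m1 * m2 ^+ 2 + m0 * m3 * m2 *+ 2) + c0 * m3 * m2 ^+ 2 *+ 3.
pose r0 := c3 * m0 ^+ 3 + c2 * m0 ^+ 2 * m2 + c1 * m0 * m2 ^+ 2 + c0 * m2 ^+ 3.
have [k rE] : exists k, forall i, nth 0 [:: r0; r1; r2;
  r3] i = k * (cubic_poly T)`_i.
  move: dvd_p; set R := \sum_i _.
  have -> : R = \poly_(i < 4) nth 0 [:: r0; r1; r2; r3] i.
    rewrite /R sum_I4 poly_def sum_I4 /= -!mul_polyC !coef_poly /=.
    rewrite /r0 /r1 /r2 /r3 -/c0 -/c1 -/c2 -/c3.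
    rewrite !(rmorphD, rmorphM, rmorphXn, rmorphMn) /=; ring.
  case/dvdpP=> q eR; exists q`_0 => i.
  (* The substituted form has degree at most 3 and is divisible by a cubic, so the quotient is a
     constant k. *)
  have sz_q : (size q <= 1)%N.
    have [-> | q0] := eqVneq q 0; first by rewrite size_poly0.
    have := size_poly 4 (nth 0 [:: r0; r1; r2; r3]).
    rewrite eR size_mul //; last by rewrite -size_poly_eq0 szp.
    by rewrite szp addnC /= addSn.
  have := congr1 (fun p : {poly F} => p`_i) eR.
  rewrite [in q * _](size1_polyC sz_q) coefCM coef_poly => <-.
  by case: i => [|[|[|[|i]]]] //=; rewrite nth_nil.
have := (rE 0%N, rE 1%N, rE 2%N, rE 3%N); rewrite !coef_poly /=.
rewrite /r0 /r1 /r2 /r3 /c0 /c1 /c2 /c3 => -[[[e0 e1] e2] e3].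
have E3 : k * T 1 0 ^+ 2 = m1 * (T' 1 0 * m1 + T' 1 1 * m3) ^+ 2
      + m3 * (T' 0 0 * m1 + T' 0 1 * m3) ^+ 2.
  rewrite -e3; apply: (eq_mod2 ch2 (- (T' 1 0 * T' 1 1 * m1 ^+ 2 * m3
    + T' 0 0 * T' 0 1 * m1 * m3 ^+ 2))); ring.
have E2 : k * T 0 0 ^+ 2 = m0 * (T' 1 0 * m1 + T' 1 1 * m3) ^+ 2
      + m2 * (T' 0 0 * m1 + T' 0 1 * m3) ^+ 2.
  rewrite -e2; apply: (eq_mod2 ch2 (T' 1 0 ^+ 2 * m1 ^+ 2 * m0
    + T' 0 0 ^+ 2 * m1 * m0 * m3 + T' 1 1 ^+ 2 * m1 * m3 * m2
    + T' 0 1 ^+ 2 * m3 ^+ 2 * m2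
    - T' 1 0 * T' 1 1 * m1 * m3 * m0 - T' 0 0 * T' 0 1 * m1 * m3 * m2)); ring.
have E1 : k * T 1 1 ^+ 2 = m1 * (T' 1 0 * m0 + T' 1 1 * m2) ^+ 2
      + m3 * (T' 0 0 * m0 + T' 0 1 * m2) ^+ 2.
  rewrite -e1; apply: (eq_mod2 ch2 (T' 1 0 ^+ 2 * m1 * m0 ^+ 2
    + T' 0 0 ^+ 2 * m1 * m0 * m2 + T' 1 1 ^+ 2 * m0 * m3 * m2
    + T' 0 1 ^+ 2 * m3 * m2 ^+ 2
    - T' 1 0 * T' 1 1 * m0 * m2 * m1 - T' 0 0 * T' 0 1 * m0 * m2 * m3)); ring.
have E0 : k * T 0 1 ^+ 2 = m0 * (T' 1 0 * m0 + T' 1 1 * m2) ^+ 2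
      + m2 * (T' 0 0 * m0 + T' 0 1 * m2) ^+ 2.
  rewrite -e0; apply: (eq_mod2 ch2 (- (T' 1 0 * T' 1 1 * m0 ^+ 2 * m2
    + T' 0 0 * T' 0 1 * m0 * m2 ^+ 2))); ring.
have C3 : cubic T' m1 m3 = k * T 1 0 ^+ 2 by rewrite E3.
have C0 : cubic T' m0 m2 = k * T 0 1 ^+ 2 by rewrite E0.
have k0 : k != 0.
  apply/negP=> /eqP k0; apply: nz; move: C3 C0; rewrite k0 !mul0r.
  by move=> /anT'[-> ->] /anT'[-> ->].
exists k, m0, m1, m2, m3; split=> //.
(* The substitution is nonsingular: a vector it kills would be a zero of the form of [T]. *)
have ker a e : m1 * a + m0 * e = 0 -> m3 * a + m2 * e = 0 -> a = 0 /\ e = 0.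
  move=> z1 z3; apply: anT; apply: (mulfI k0); rewrite mulr0.
  transitivity ((k * T 1 0 ^+ 2) * a ^+ 3 + (k * T 0 0 ^+ 2) * a ^+ 2 * e
    + (k * T 1 1 ^+ 2) * a * e ^+ 2 + (k * T 0 1 ^+ 2) * e ^+ 3).
    by apply: (eq_mod2 ch2 (k * (T 1 0 * T 1 1 * a ^+ 2 * e
      + T 0 0 * T 0 1 * a * e ^+ 2))); rewrite /cubic; ring.
  have <- : cubic T' (m1 * a + m0 * e) (m3 * a + m2 * e) = 0.
    by rewrite z1 z3 /cubic; ring.
  rewrite E3 E2 E1 E0; apply: (eq_mod2 ch2 (- (
    (T' 1 0 * m1 + T' 1 1 * m3) * (T' 1 0 * m0 + T' 1 1 * m2) * a * e
      * (m1 * a + m0 * e)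
    + (T' 0 0 * m1 + T' 0 1 * m3) * (T' 0 0 * m0 + T' 0 1 * m2) * a * e
      * (m3 * a + m2 * e)))); rewrite /cubic; ring.
apply/negP=> /eqP d0; apply: nz.
have two (x : F) : x + x = 0 by exact: addrr_pchar2.
(* If the determinant vanishes, (m0,m1) and (m2,m3) both lie in the kernel, so all m's are 0. *)
have [] := ker m0 m1; [by rewrite mulrC two | by rewrite -d0; ring |].
have [] := ker m2 m3; [by rewrite -d0; ring | by rewrite mulrC two |].
by move=> -> -> -> ->.
Qed.

(** All terms in the equations of [anisotropic_mobius] are squares once k and the m's are replaced
    by squares of s and the n's. Taking roots gives N T = (d/s) T' phi(N), with N = [n1,n0;n3,n2] of
    determinant d. *)
Lemma anisotropic_equiv T T' : anisotropic T -> anisotropic T' ->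
  frob_equiv ch2 T T'.
Proof.
move=> anT anT'.
have [k [m0 [m1 [m2 [m3]]]]] := anisotropic_mobius anT anT'.
have [s <-] := sqr_surj ch2 k; have [n0 <-] := sqr_surj ch2 m0.
have [n1 <-] := sqr_surj ch2 m1; have [n2 <-] := sqr_surj ch2 m2.
have [n3 <-] := sqr_surj ch2 m3; rewrite expf_eq0 /= => -[s0 d0].
set D1 := T' 0 0 * n1 ^+ 2 + _; set F1 := T' 1 0 * n1 ^+ 2 + _.
set D0 := T' 0 0 * n0 ^+ 2 + _; set F0 := T' 1 0 * n0 ^+ 2 + _.
have root2 (a u v d f : F) : s ^+ 2 * a ^+ 2 = u ^+ 2 * f ^+ 2 + v ^+ 2 * d ^+
  2 ->
    s * a = u * f + v * d.
  move=> e; apply: (sqr_inj ch2) => /=; rewrite exprMn e.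
  by apply: (eq_mod2 ch2 (- (u * f * v * d))); ring.
case=> /root2 e10 /root2 e00 /root2 e11 /root2 e01.
pose d := n1 * n2 + n0 * n3.
have dn0 : d != 0.
  apply: contraNneq d0 => d0; apply/eqP.
  transitivity (d ^+ 2); last by rewrite d0 expr0n.
  by apply: (eq_mod2 ch2 (- (n1 * n2 * n0 * n3))); rewrite /d; ring.
(* Scaling N by r absorbs the factor d/s, because phi(r N) = r^2 phi(N). *)
pose r := d / s.
have r0 : r != 0 by rewrite mulf_neq0 ?invr_neq0.
exists (mx2 (r * n1) (r * n0) (r * n3) (r * n2)).
  rewrite unitmx2 !mx2E.
  have -> : r * n1 * (r * n2) - r * n0 * (r * n3) = r ^+ 2 * d.
    by apply: (eq_mod2 ch2 (- (r ^+ 2 * n0 * n3))); rewrite /d; ring.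
  by rewrite mulf_neq0 // expf_neq0.
have scaled x y : s * x = d * y -> r * x = r ^+ 2 * y.
  move=> e; apply: (mulfI s0); rewrite mulrCA e /r; field; exact: s0.
rewrite [T in _ *m T]mx2_eta [T' in RHS]mx2_eta map_mx2 !mul_mx2
  !pFrobenius_autE.
congr mx2.
- transitivity (r * (n1 * T 0 0 + n0 * T 1 0)); first by ring.
  transitivity (r ^+ 2 * D1); last by rewrite /D1; ring.
  apply: scaled; transitivity (n1 * (s * T 0 0) + n0 * (s * T 1 0));
    first by ring.
  by rewrite e00 e10; apply: (eq_mod2 ch2 (n0 * n1 * F1)); rewrite /d; ring.
- transitivity (r * (n1 * T 0 1 + n0 * T 1 1)); first by ring.
  transitivity (r ^+ 2 * D0); last by rewrite /D0; ring.
  apply: scaled; transitivity (n1 * (s * T 0 1) + n0 * (s * T 1 1));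
    first by ring.
  by rewrite e01 e11; apply: (eq_mod2 ch2 (n0 * n1 * F0)); rewrite /d; ring.
- transitivity (r * (n3 * T 0 0 + n2 * T 1 0)); first by ring.
  transitivity (r ^+ 2 * F1); last by rewrite /F1; ring.
  apply: scaled; transitivity (n3 * (s * T 0 0) + n2 * (s * T 1 0));
    first by ring.
  by rewrite e00 e10; apply: (eq_mod2 ch2 (n2 * n3 * D1)); rewrite /d; ring.
- transitivity (r * (n3 * T 0 1 + n2 * T 1 1)); first by ring.
  transitivity (r ^+ 2 * F0); last by rewrite /F0; ring.
  apply: scaled; transitivity (n3 * (s * T 0 1) + n2 * (s * T 1 1));
    first by ring.
  by rewrite e01 e11; apply: (eq_mod2 ch2 (n2 * n3 * D0)); rewrite /d; ring.
Qed.

End Classification.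

(** * Reduction to the planes attached to 2 x 2 matrices *)

Section Points.

Variable F : finFieldType.
Implicit Types (v y P : 'rV[F]_6) (U : {vspace 'rV[F]_6}) (u l : 'rV[F]_3).

Lemma mem_points v U : v != 0 -> (point v \in points U) = (v \in U).
Proof.
move=> v0; apply/imsetP/idP=> [[w] | vU]; last by exists v => //;
  rewrite inE vU v0.
rewrite inE => /andP[wU _] /setP/(_ v); rewrite !inE memv_line => /esym vw.
by apply: subvP vw; rewrite -memvE.
Qed.

Lemma veronese_neq0 u : u != 0 -> veronese u != 0.
Proof.
apply: contra => /eqP/rowP v0; have := (v0 0, v0 3, v0 5).
rewrite !row6E !mxE => -[[/eqP u0 /eqP u1] /eqP u2].
rewrite !expf_eq0 /= in u0 u1 u2.
by apply/eqP/rowP; elim/forall_I3; rewrite mxE; apply/eqP.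
Qed.

Definition rv3 (a b c : F) : 'rV[F]_3 := \row_j nth 0 [:: a; b; c] j.

Lemma rv3E a b c (v := rv3 a b c) : (v 0 0 = a) * (v 0 1 = b) * (v 0 2 = c).
Proof. by rewrite /v !mxE. Qed.

Lemma exists_unitmx_row l : l != 0 ->
  exists2 A : 'M[F]_3, A \in unitmx & exists2 c, c != 0 & l = c *: row 2 A.
Proof.
move=> l0; pose A := xrow 0 2 (row_ebase l).
have uA : A \in unitmx by rewrite /A xrowE unitmx_mul unitmx_perm
  row_ebase_unit.
exists A => //; exists (col_ebase l 0 0).
  by have := col_ebase_unit l; rewrite unitmxE det_mx11 unitfE.
rewrite -[LHS]mulmx_ebase rank_rV l0.
have -> : row 2 A = row 0 (row_ebase l).
  by apply/rowP=> j; rewrite !mxE tpermR.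
rewrite (mx11_scalar (col_ebase l)) mul_scalar_mx -scalemxAl.
rewrite [_ *m row_ebase l](_ : _ = row 0 (row_ebase l));
  first by rewrite !mxE eqxx.
apply/rowP=> j; rewrite rowE; congr ((_ *m _) _ _).
by apply/rowP=> k; rewrite !mxE; move: k; elim/forall_I3.
Qed.

End Points.

Section Reduction.

Variables (F : finFieldType) (ch2 : 2%N \in [pchar F]).
Implicit Types (v y P : 'rV[F]_6) (U E pi : {vspace 'rV[F]_6}).
Implicit Types (u l w : 'rV[F]_3).

Lemma conic_veronese (A : 'M[F]_3) c l w : A \in unitmx -> l = c *: row 2 A ->
    w 0 2 = 0 -> w != 0 ->
  [/\ Kact A (veronese (w *m (invmx A)^T)) = veronese w,
      veronese (w *m (invmx A)^T) != 0
    & point (veronese (w *m (invmx A)^T)) \in conic l].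
Proof.
move=> uA lE w2 w0; set u := w *m _.
have uw : u *m A^T = w by rewrite -mulmxA -trmx_mul mulmxV // trmx1 mulmx1.
have u0 : u != 0 by apply: contraNneq w0 => u0; rewrite -uw u0 mul0mx.
split; [by rewrite Kact_veronese uw | exact: veronese_neq0 |].
apply/imsetP; exists u => //; rewrite inE u0 /= lE linearZ -scalemxAr /=.
suff -> : u *m (row 2 A)^T = 0 by rewrite scaler0.
clearbody u; apply/matrixP=> i j;
  rewrite !ord1 [RHS]mxE -w2 -uw [LHS]mxE [RHS]mxE.
by apply: eq_bigr => k _; rewrite !mxE.
Qed.

(* E is spanned by the conic points veronese w for w = (1,0,0), (0,1,0) and    *)
(* (1,1,0), in the coordinates where the line of the conic is X_2 = 0.        *)
Lemma conic_plane_coord (A : 'M[F]_3) c l E y : A \in unitmx ->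
    l = c *: row 2 A -> \dim E = 3%N -> conic l \subset points E -> y \in E ->
  [/\ Kact A y 0 2 = 0, Kact A y 0 4 = 0 & Kact A y 0 5 = 0].
Proof.
move=> uA lE dimE sCE Ey.
pose E' := (linfun (Kact A) @: E)%VS.
have sub w : w 0 2 = 0 -> w != 0 -> veronese w \in E'.
  move=> w2 w0; have [<- v0 Cv] := conic_veronese uA lE w2 w0.
  rewrite -[Kact A _](lfunE (Kact A)) memv_img // -mem_points //.
  exact: (subsetP sCE).
pose E0 := plane_of (fun x y z : F =>
  mx3 [:: [:: x; y; 0]; [:: y; z; 0]; [:: 0; 0; 0]]).
have dimE0 : \dim E0 = 3%N.
  apply/eqP; rewrite -[_ == _]/(free _) -[X in free X]/(val [tuple _; _; _]).
  apply/freeP=> k; rewrite sum_I3 /= !symcoord_mx3 !scale_row6 !add_row6 =>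
    /rowP k0.
  have := (k0 0, k0 1, k0 3); rewrite !row6E !mxE.
  rewrite !mulr0 !mulr1 !addr0 !add0r => -[[k00 k01] k02].
  by elim/forall_I3.
have nz (a b : F) : (a != 0) || (b != 0) -> rv3 a b 0 != 0.
  apply: contraL => /eqP/rowP e; have := (e 0, e 1).
  by rewrite !rv3E !mxE => -[-> ->]; rewrite eqxx.
have vE (a b : F) : veronese (rv3 a b 0) = row6 [:: a ^+ 2; a * b; 0; b ^+ 2;
  0; 0].
  by rewrite /veronese !rv3E !mulr0 expr0n.
have v1 : row6 [:: 1; 0; 0; 0; 0; 0] \in E'.
  have := sub (rv3 1 0 0); rewrite vE expr1n mulr0 expr0n /=.
  by apply; rewrite ?rv3E // nz // oner_eq0.
have v2 : row6 [:: 0; 0; 0; 1; 0; 0] \in E'.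
  have := sub (rv3 0 1 0); rewrite vE expr1n mul0r expr0n /=.
  by apply; rewrite ?rv3E // nz // oner_eq0 orbT.
have v3 : row6 [:: 1; 1; 0; 1; 0; 0] \in E'.
  have := sub (rv3 1 1 0); rewrite vE expr1n mulr1 /=.
  by apply; rewrite ?rv3E // nz // oner_eq0.
have EE0 : E' = E0.
  apply/esym/eqP; rewrite eqEdim dim_Kimg // dimE dimE0 andbT.
  apply/subvP=> _ /mem_plane_of[a [b [d ->]]]; rewrite !symcoord_mx3.
  rewrite !memvD ?memvZ //.
  have -> : row6 [:: 0; 1; 0; 0; 0; 0] = row6 [:: 1; 1; 0; 1; 0; 0]
     + (-1) *: row6 [:: 1; 0; 0; 0; 0; 0] + (-1) *: row6 [:: 0; 0; 0; 1; 0;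
       0] :> 'rV[F]_6.
    by rewrite !scale_row6 !add_row6; congr row6; congr [:: _; _; _; _; _; _];
      ring.
  by rewrite !memvD ?memvZ.
have : Kact A y \in E' by rewrite -[Kact A _](lfunE (Kact A)) memv_img.
rewrite EE0 => /mem_plane_of[a [b [d ->]]].
rewrite !symcoord_mx3 !scale_row6 !add_row6 !row6E; split; ring.
Qed.

(** With the line l of C(P) as last row of [A], the image P' of P has only the coordinate Y_1. The
    double line of H(P) must be l itself, since H(P) contains the conic, so Y_5 vanishes on the
    image W of pi. The projection of W to (Y_0,Y_3) has kernel spanned by P', hence is onto, and
    (Y_2,Y_4) becomes a linear function T of it. *)
Lemma normal_form pi P HP Hpi :
  \dim pi = 3%N -> [disjoint points pi & veronese_surface F] ->
  P != 0 -> (pi :&: nucleus_plane F)%VS = <[P]>%VS ->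
  is_H_point P HP -> is_H_plane pi Hpi -> HP = Hpi ->
  exists2 T, T \in unitmx & Korbit pi (normal_plane T).
Proof.
move=> dimpi dis P0 piN [C [[l l0 ->] [E [dimE sCE EP _ _]] [l' l'0 ->] sCH]]
  [_ sH] eH.
rewrite -{}eH in sH.
have [A uA [c c0 lE]] := exists_unitmx_row l0.
have [P2 P4 P5] := conic_plane_coord uA lE dimE sCE EP.
set P' := Kact A P in P2 P4 P5.
have PN : P \in (pi :&: nucleus_plane F)%VS by rewrite piN memv_line.
move: PN; rewrite memv_cap => /andP[Ppi PN].
have : P' \in nucleus_plane F by rewrite Kact_nucleus.
rewrite mem_nucleus => /and3P[/eqP P'0 /eqP P'3 _].
have P'nz : P' != 0.
  apply: contraNneq P0 => e; apply/eqP/(Kact_inj uA).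
  by rewrite -/P' e linear0.
have P'1 : P' 0 1 != 0.
  apply: contraNneq P'nz => P'1; apply/eqP/rowP.
  by elim/forall_I6; rewrite [RHS]mxE.
pose k := l' *m invmx A.
have kA : l' = k *m A by rewrite mulmxKV.
(* On the Veronese point of w the double-line form is (k . w)^2, so k vanishes on the whole line X_2
   = 0. *)
have k_perp w : w 0 2 = 0 -> k *m w^T = 0.
  have [-> _ | w0 w2] := eqVneq w 0; first by rewrite trmx0 mulmx0.
  have [_ v0 Cv] := conic_veronese uA lE w2 w0.
  have := subsetP sCH _ Cv; rewrite mem_points // (double_line_form ch2).
  rewrite symmx_veronese trmx_mul trmxK !mulmxA -/k.
  have -> : k *m w^T *m w *m (invmx A)^T *m l'^T = (k *m w^T) *m (k *m w^T)^T.
    by rewrite trmx_mul trmxK /k trmx_mul !mulmxA.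
  rewrite (mx11_scalar (k *m w^T)); move: ((k *m w^T) 0 0) => a.
  rewrite tr_scalar_mx -scalar_mxM => /eqP/matrixP/(_ 0 0).
  by rewrite !mxE /= mulr1n => /eqP; rewrite mulf_eq0 orbb => /eqP ->;
    rewrite raddf0.
clearbody k.
have [k0 k1] : k 0 0 = 0 /\ k 0 1 = 0.
  split.
    have /matrixP/(_ 0 0) := k_perp (rv3 1 0 0) (rv3E _ _ _).2.
    by rewrite !mxE sum_I3 !mxE /= !mulr0 mulr1 !addr0.
  have /matrixP/(_ 0 0) := k_perp (rv3 0 1 0) (rv3E _ _ _).2.
  by rewrite !mxE sum_I3 !mxE /= !mulr0 mulr1 !addr0 add0r.
have k2 : k 0 2 != 0.
  apply: contraNneq l'0 => k2; rewrite kA (_ : k = 0) ?mul0mx //.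
  by apply/rowP; elim/forall_I3; rewrite [RHS]mxE.
have coord5 y : y \in pi -> Kact A y 0 5 = 0.
  move/(subvP sH); rewrite (double_line_form ch2) kA trmx_mul.
  have -> : k *m A *m symmx y *m (A^T *m k^T) = k *m symmx (Kact A y) *m k^T.
    by rewrite symmx_Kact !mulmxA.
  rewrite -(double_line_form ch2) (mem_double_line ch2) k0 k1 expr0n /= !mul0r
    !add0r.
  by rewrite mulf_eq0 expf_eq0 (negPf k2) /= => /eqP.
pose W := (linfun (Kact A) @: pi)%VS.
have dimW : \dim W = 3%N by rewrite dim_Kimg.
have W5 y : y \in W -> y 0 5 = 0 by case/memv_imgP=> x xpi ->;
  rewrite lfunE /= coord5.
have WN y : y \in W -> y \in nucleus_plane F -> y \in <[P']>%VS.
  case/memv_imgP=> x xpi ->; rewrite lfunE /= Kact_nucleus // => xN.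
  have : x \in (pi :&: nucleus_plane F)%VS by rewrite memv_cap xpi.
  by rewrite piN => /vlineP[a ->]; rewrite linearZ /= memvZ // memv_line.
have WP : P' \in W by rewrite -[P'](lfunE (Kact A)) memv_img.
pose M : 'M[F]_(6, 2) := \matrix_(i, j) (i == (if j == 0 then 0 else 3))%:R.
pose f := linfun (mulmxr M : 'rV[F]_6 -> 'rV[F]_2).
have fE y : (f y 0 0 = y 0 0) * (f y 0 1 = y 0 3).
  rewrite lfunE /= !mxE !sum_I6 !mxE /=.
  by rewrite !mulr0 !mulr1 !addr0 !add0r.
have fW : (f @: W)%VS = fullv.
  apply/eqP; rewrite eqEdim subvf dimvf /dim /= mul1n.
  have : (\dim (W :&: lker f) <= 1)%N.
    apply: (@leq_trans (\dim <[P']>)); last by rewrite dim_vline P'nz.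
    apply: dimvS; apply/subvP=> y;
      rewrite memv_cap memv_ker => /andP[Wy /eqP fy].
    apply: WN => //; rewrite mem_nucleus (W5 _ Wy) -(fE y).1 -(fE y).2 fy.
    by rewrite !mxE eqxx.
  move=> dk; have := limg_ker_dim f W; rewrite dimW => e.
  by rewrite -(leq_add2l 1) -[(1 + 2)%N]e leq_add2r.
have [w1 Ww1 fw1] : exists2 w, w \in W & f w = delta_mx 0 0.
  have : delta_mx 0 0 \in (f @: W)%VS by rewrite fW memvf.
  by case/memv_imgP=> w; exists w.
have [w2 Ww2 fw2] : exists2 w, w \in W & f w = delta_mx 0 1.
  have : delta_mx 0 1 \in (f @: W)%VS by rewrite fW memvf.
  by case/memv_imgP=> w; exists w.
have := (fE w1, fE w2); rewrite fw1 fw2 !mxE /= => -[[w10 w13] [w20 w23]].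
(* The columns of [T] are the values of (Y_2,Y_4) on lifts of the two unit vectors. *)
pose T := mx2 (w1 0 2) (w2 0 2) (w1 0 4) (w2 0 4).
clearbody P'.
have TW : normal_plane T = W.
  apply/eqP; rewrite eqEdim dimW dim_normal andbT.
  apply/subvP=> _ /normal_planeP[a [y [e ->]]].
  have -> : normal_vec T a y e = a *: w1 + e *: w2
      + ((y - a * w1 0 1 - e * w2 0 1) / P' 0 1) *: P'.
    rewrite /normal_vec !mx2E [w1]row6_eta [w2]row6_eta [P']row6_eta.
    rewrite !scale_row6 !add_row6 !row6E -w10 -w13 -w20 -w23 P'0 P'3 P2 P4 P5.
    rewrite (W5 _ Ww1) (W5 _ Ww2).
    by congr row6; congr [:: _; _; _; _; _; _]; field.
  by rewrite !memvD ?memvZ.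
exists T; last by exists A.
clearbody T.
rewrite unitmxE unitfE -det_tr; apply/det0P=> -[v v0 vT].
have vT' j : T j 0 * v 0 0 + T j 1 * v 0 1 = 0.
  move/rowP/(_ j): vT; rewrite !mxE sum_I2 !mxE => <-.
  by rewrite ![_ * v _ _]mulrC.
(* A kernel vector of [T] can be written (a^2,e^2); with y = a e it gives the Veronese point of
   (a,e,0), contradicting disjointness. *)
have [a ea] := sqr_surj ch2 (v 0 0); have [e ee] := sqr_surj ch2 (v 0 1).
rewrite -ea -ee in vT'.
have wE : veronese (rv3 a e 0) = normal_vec T (a ^+ 2) (a * e) (e ^+ 2).
  by rewrite /normal_vec !vT' /veronese !rv3E !mulr0 expr0n.
have w0 : rv3 a e 0 != 0.
  apply: contraNneq v0 => /rowP w0; have := (w0 0, w0 1).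
  rewrite !rv3E !mxE => -[a0 e0]; apply/eqP/rowP.
  by elim/forall_I2; rewrite mxE -?ea -?ee ?a0 ?e0 expr0n.
have [uw u0 /imsetP[u]] := conic_veronese uA lE (rv3E _ _ _).2 w0.
rewrite inE => /andP[unz _] eu.
have : point (veronese u) \in points pi.
  rewrite -eu mem_points // -[veronese _](KactK uA) uw -mem_Kimg // -/W -TW wE.
  by apply/normal_planeP; exists (a ^+ 2), (a * e), (e ^+ 2).
move/(disjointFr dis) => /negP; apply.
by apply/imsetP; exists u => //; rewrite inE.
Qed.

End Reduction.

(** * Point-orbit distributions *)

Section Counting.

Variables (F : finFieldType).
Implicit Types (v : 'rV[F]_6) (U W : {vspace 'rV[F]_6}).
Let q := #|F|.

Definition vectors_of U (Q : pred 'rV[F]_6) : {set 'rV[F]_6} :=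
  [set v | [&& v \in U, v != 0 & Q v]].

Definition scale_invariant (Q : pred 'rV[F]_6) :=
  forall c v, c != 0 -> Q (c *: v) = Q v.

(** Each projective point carries q - 1 nonzero vectors, so points can be counted through
    vectors. *)
Lemma card_vectors_of U Q : scale_invariant Q ->
  #|vectors_of U Q| = (count_points U Q * q.-1)%N.
Proof.
move=> invQ; rewrite /count_points -/(vectors_of U Q).
rewrite -sum1_card (partition_big_imset (@point F)) /= -sum_nat_const.
apply: eq_bigr => _ /imsetP[v vUQ ->]; move: vUQ;
  rewrite inE => /and3P[vU v0 Qv].
rewrite sum1dep_card.
transitivity #|point v :\ 0|.
  apply: eq_card => w; rewrite !inE;
    apply/andP/andP=> [[/and3P[_ w0 _] /eqP e] | [w0]].
    by split=> //; have := memv_line w; move/setP/(_ w): e; rewrite !inE => ->.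
  case/vlineP=> c wE; have c0 : c != 0 by apply: contraNneq w0 => c0;
    rewrite wE c0 scale0r.
  rewrite wE invQ // memvZ // Qv -wE w0; split=> //.
  rewrite /point; suff -> : <[w]>%VS = <[v]>%VS by [].
  by apply/eqP; rewrite eqEdim !dim_vline w0 v0 andbT -memvE wE memvZ //
    memv_line.
have := cardsD1 0 (point v); rewrite inE mem0v.
have -> : #|point v| = q.
  rewrite /point cardsE; have := card_vspace <[v]>%VS.
  by rewrite dim_vline v0 expn1.
by move=> ->.
Qed.

Lemma Kimg_vectors (A : 'M[F]_3) U Q : A \in unitmx ->
  (forall v, Q (Kact A v) = Q v) ->
  #|vectors_of (linfun (Kact A) @: U) Q| = #|vectors_of U Q|.
Proof.
move=> uA QA; rewrite -(card_imset (mem (vectors_of U Q)) (Kact_inj uA)).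
apply: eq_card => v; rewrite inE mem_Kimg //;
  apply/idP/imsetP=> [/and3P[vU v0 Qv] | ].
  exists (Kact (invmx A) v); last by rewrite KactVK.
  rewrite inE vU -QA KactVK // Qv andbT.
  by apply: contraNneq v0 => e; rewrite -(KactVK uA v) e linear0.
case=> w; rewrite inE => /and3P[wU w0 Qw] ->; rewrite KactK // wU QA Qw andbT.
by apply: contraNneq w0 => e; apply/eqP/(Kact_inj uA); rewrite e linear0.
Qed.

Lemma symmx_scale c v : symmx (c *: v) = c *: symmx v.
Proof. by apply/matrixP; do 2!elim/forall_I3; rewrite [RHS]mxE !symmxE mxE. Qed.

Lemma symmx_eq0 v : (symmx v == 0) = (v == 0).
Proof.
rewrite -(inj_eq (@symmx_inj F)); congr (_ == _).
by apply/matrixP; do 2!elim/forall_I3; rewrite [LHS]mxE symmxE mxE.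
Qed.

Lemma scale_invariant_rank r : scale_invariant (fun v => \rank (symmx v) == r).
Proof. by move=> c v c0; rewrite symmx_scale mxrank_scale_nz. Qed.

Lemma scale_invariant_nucleus : scale_invariant (fun v => v \in nucleus_plane
  F).
Proof. by move=> c v c0; rewrite rpredZeq (negPf c0). Qed.

Lemma rank_Kact (A : 'M[F]_3) v : A \in unitmx ->
  \rank (symmx (Kact A v)) = \rank (symmx v).
Proof.
move=> uA; rewrite symmx_Kact mxrankMfree ?row_free_unit ?unitmx_tr //.
by rewrite -mxrank_tr trmx_mul mxrankMfree ?row_free_unit ?unitmx_tr //
  mxrank_tr.
Qed.

Lemma OD0_Korbit (ch2 : 2%N \in [pchar F]) U W : (1 < q)%N -> Korbit U W -> OD0
  W = OD0 U.
Proof.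
move=> q1 [A uA ->]; have q'0 : (0 < q.-1)%N by rewrite -ltnS prednK // ltnW.
have cnt Q : scale_invariant Q -> (forall v, Q (Kact A v) = Q v) ->
    count_points (linfun (Kact A) @: U) Q = count_points U Q.
  move=> invQ QA; apply/eqP; rewrite -(eqn_pmul2r q'0) -!card_vectors_of //.
  by rewrite Kimg_vectors.
have r v := rank_Kact v uA; have n v := Kact_nucleus ch2 v uA.
congr [:: _; _; _; _]; apply: cnt => [|v]; rewrite ?r ?n //.
- exact: scale_invariant_rank.
- exact: scale_invariant_nucleus.
- by move=> c v c0; rewrite scale_invariant_rank // scale_invariant_nucleus.
- exact: scale_invariant_rank.
Qed.

Lemma rank1_minor (M : 'M[F]_3) i j k l : \rank M = 1%N ->
  M i j * M k l = M i l * M k j.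
Proof.
(* The inner dimension of the rank factorization is generalized so that it can be replaced by 1. *)
have gen r (C : 'M[F]_(3, r)) (R : 'M[F]_(r, 3)) : r = 1%N ->
    (C *m R) i j * (C *m R) k l = (C *m R) i l * (C *m R) k j.
  by move=> r1; subst r; rewrite !mxE !big_ord1; ring.
by move=> r1; rewrite -(mulmx_base M); apply: gen.
Qed.

End Counting.

Section NormalPlane.

Variables (F : finFieldType) (ch2 : 2%N \in [pchar F]).
Variable T : 'M[F]_2.
Hypothesis uT : T \in unitmx.
Let q := #|F|.

Definition cubic_zeros : {set F * F} :=
  [set p | (p != (0, 0)) && (cubic T p.1 p.2 == 0)].

(** The only terms involving y are y d f taken twice and y^2 times the zero corner, so the
    determinant does not depend on y. *)
Lemma det_normal a y e : \det (symmx (normal_vec T a y e)) = cubic T a e.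
Proof.
rewrite det_mx3 !symmxE !row6E /cubic.
set d := T 0 0 * a + _; set f := T 1 0 * a + _.
by apply: (eq_mod2 ch2 (y * f * d - a * f ^+ 2 - e * d ^+ 2)); ring.
Qed.

Lemma normal_vec_eq0 a y e :
  (normal_vec T a y e == 0) = [&& a == 0, y == 0 & e == 0].
Proof.
apply/eqP/and3P=> [/rowP e0 | [/eqP -> /eqP -> /eqP ->]].
  by have := (e0 0, e0 1, e0 3); rewrite !row6E !mxE => -[[-> ->] ->].
by rewrite /normal_vec !mulr0 !addr0; apply/rowP; elim/forall_I6;
  rewrite row6E mxE.
Qed.

Lemma normal_vec_nucleus a y e :
  (normal_vec T a y e \in nucleus_plane F) = ((a, e) == (0, 0)).
Proof. by rewrite mem_nucleus !row6E eqxx andbT. Qed.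

Lemma rank_normal3 a y e :
  (\rank (symmx (normal_vec T a y e)) == 3%N) = (cubic T a e != 0).
Proof. by rewrite -/(row_free _) row_free_unit unitmxE unitfE det_normal. Qed.

(** The zero corner and the vanishing 2 x 2 minors force d = f = 0. Then a = e = 0 as T is
    invertible, and finally y = 0. *)
Lemma rank_normal_neq1 a y e : \rank (symmx (normal_vec T a y e)) != 1%N.
Proof.
apply/eqP=> r1; have m i j k l := rank1_minor i j k l r1.
have := (m 0 0 2 2, m 1 1 2 2, m 0 0 1 1); rewrite !symmxE !row6E !mulr0.
case; case=> /esym/eqP; rewrite -expr2 expf_eq0 /= => /eqP d0.
move=> /esym/eqP; rewrite -expr2 expf_eq0 /= => /eqP f0.
have [-> ->] := unitmx2_ker uT d0 f0; rewrite mul0r => /esym/eqP.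
rewrite -expr2 expf_eq0 /= => /eqP y0; move: r1.
have /eqP -> : normal_vec T a y e == 0.
  by have [a0 e0] := unitmx2_ker uT d0 f0; rewrite normal_vec_eq0 a0 y0 e0 eqxx.
by have /eqP -> := etrans (symmx_eq0 (0 : 'rV[F]_6)) (eqxx _); rewrite mxrank0.
Qed.

Lemma rank_normal2 a y e : (a, e) != (0, 0) ->
  (\rank (symmx (normal_vec T a y e)) == 2%N) = (cubic T a e == 0).
Proof.
move=> nz; have := rank_normal3 a y e; have := rank_normal_neq1 a y e.
have : \rank (symmx (normal_vec T a y e)) != 0%N.
  rewrite mxrank_eq0 symmx_eq0 normal_vec_eq0; apply: contra nz.
  by case/and3P=> /eqP -> _ /eqP ->.
have := rank_leq_row (symmx (normal_vec T a y e)).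
by case: (cubic T a e == 0); case: (\rank _) => [|[|[|[|]]]].
Qed.

Definition normal_param (t : F * (F * F)) := normal_vec T t.2.1 t.1 t.2.2.

Lemma normal_param_inj : injective normal_param.
Proof. by move=> [y [a e]] [y' [a' e']] /normal_vec_inj[/= -> -> ->]. Qed.

Lemma card_normal_vectors Q :
  #|vectors_of (normal_plane T) Q| =
  #|[set t | (normal_param t != 0) && Q (normal_param t)]|.
Proof.
rewrite -[RHS](card_imset _ normal_param_inj); apply: eq_card => v.
rewrite inE; apply/and3P/imsetP=> [[/normal_planeP[a [y [e ->]]] v0 Qv] | ].
  by exists (y, (a, e)) => //; rewrite inE v0.
case=> -[y [a e]]; rewrite inE => /andP[v0 Qv] ->; split=> //.
by apply/normal_planeP; exists a, y, e.
Qed.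

(** Rank and membership in the nucleus plane depend only on (a,e) for nonzero vectors of the plane:
    (0,0) is the nucleus point, nontrivial zeros of the form have rank 2, all others rank 3. The
    coordinate y is free and contributes the factor q. *)
Lemma OD0_normal n : (1 < q)%N -> (n <= q.+1)%N ->
  #|cubic_zeros| = (n * q.-1)%N ->
  OD0 (normal_plane T) = [:: 0; 1; q * n; q * (q.+1 - n)]%N.
Proof.
move=> q1 nq Zn; have q0 : (0 < q)%N by rewrite ltnW.
have q'0 : (0 < q.-1)%N by rewrite -ltnS prednK.
have cnt Q k : scale_invariant Q -> #|vectors_of (normal_plane T) Q| = (k *
  q.-1)%N ->
    count_points (normal_plane T) Q = k.
  by move=> invQ; rewrite card_vectors_of // => /eqP;
    rewrite eqn_pmul2r // => /eqP.
congr [:: _; _; _; _]; apply: cnt; rewrite ?card_normal_vectors.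
- exact: scale_invariant_rank.
- apply: eq_card0 => -[y [a e]]; rewrite !inE.
  by rewrite (negPf (rank_normal_neq1 _ _ _)) andbF.
- exact: scale_invariant_nucleus.
- rewrite mul1n; transitivity #|setX [set~ (0 : F)] [set (0 : F, 0 : F)]|.
    apply: eq_card => -[y [a e]]; rewrite !inE /normal_param normal_vec_eq0.
    rewrite normal_vec_nucleus /= xpair_eqE.
    by case: (a == 0); case: (y == 0); case: (e == 0).
  by rewrite cardsX cards1 muln1 cardsC1.
- by move=> c v c0; rewrite scale_invariant_rank // scale_invariant_nucleus.
- transitivity #|setX [set: F] cubic_zeros|.
    apply: eq_card => -[y [a e]];
      rewrite !inE /normal_param normal_vec_nucleus /=.
    have [/eqP | nz] := eqVneq (a, e) (0, 0); first by rewrite !andbF.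
    rewrite rank_normal2 // andbT normal_vec_eq0.
    have -> // : [&& a == 0, y == 0 & e == 0] = false.
    by apply: contraNF nz => /and3P[/eqP -> _ /eqP ->].
  by rewrite cardsX cardsT Zn mulnA.
- exact: scale_invariant_rank.
transitivity #|setX [set: F] ([set~ (0, 0)] :\: cubic_zeros)|.
  apply: eq_card => -[y [a e]];
    rewrite !inE /normal_param rank_normal3 normal_vec_eq0 /=.
  have [[-> ->] | nz] := eqVneq (a, e) (0, 0).
    by rewrite /cubic !mul0r addr0 eqxx !andbF.
  have -> : [&& a == 0, y == 0 & e == 0] = false.
    by apply: contraNF nz => /and3P[/eqP -> _ /eqP ->].
  by rewrite /= andbT.
rewrite cardsX cardsT cardsD.
have /setIidPr -> : cubic_zeros \subset [set~ (0, 0)].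
  by apply/subsetP=> p; rewrite !inE => /andP[].
rewrite cardsC1 card_prod Zn -/q -mulnA; congr (_ * _)%N.
have -> : (q * q).-1 = (q.+1 * q.-1)%N.
  have sqr_pred k : (k.+1 * k.+1).-1 = (k.+2 * k)%N by rewrite mulnS addSn /=
    mulSn.
  by rewrite -(prednK q0) sqr_pred.
by rewrite mulnBl.
Qed.

End NormalPlane.

(** * Zeros of the three forms, and the classes of the representatives *)

Section ZeroCounts.

Variables (F : finFieldType) (ch2 : 2%N \in [pchar F]).
Let q := #|F|.

Lemma card_cubic_zeros_id : #|cubic_zeros (1%:M : 'M[F]_2)| = (3 * q.-1)%N.
Proof.
(* The form is a e (a + e); [g] parametrizes its three lines e = 0, a = 0 and a = e. *)
pose g (t : 'I_3 * F) : F * F :=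
  if t.1 == 0 then (t.2, 0) else if t.1 == 1 then (0, t.2) else (t.2, t.2).
pose D := setX [set: 'I_3] [set~ (0 : F)].
have <- : #|D| = (3 * q.-1)%N by rewrite cardsX cardsT card_ord cardsC1.
have g_inj : {in D &, injective g}.
  move=> [i x] [j y]; rewrite !inE /= => x0 y0.
  move: i j; do 2!elim/forall_I3; rewrite /g /= => -[] //.
  - by move=> ->.
  - by move=> xy; rewrite xy eqxx in x0.
  - by move=> _ y0'; rewrite -y0' eqxx in y0.
  - by move=> y0'; rewrite -y0' eqxx in y0.
  - by move=> ->.
  - by move=> y0'; rewrite -y0' eqxx in y0.
  - by move=> _ x0'; rewrite x0' eqxx in x0.
  - by move=> x0'; rewrite x0' eqxx in x0.
  - by move=> ->.
rewrite -(card_in_imset g_inj); apply: eq_card => -[a e].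
have cE : cubic 1%:M a e = a * e * (a + e).
  by rewrite /cubic !mxE /=; ring.
rewrite inE /= cE !mulf_eq0 xpair_eqE.
apply/andP/imsetP=> [[nz /orP[/orP[/eqP a0 | /eqP e0] | ae]] | [[i x]]].
- exists (1, e); rewrite ?inE /= /g /= ?a0 //.
  by move: nz; rewrite a0 eqxx.
- exists (0, a); rewrite ?inE /= /g /= ?e0 //.
  by move: nz; rewrite e0 eqxx andbT.
- have {ae} ae : a = e by apply/eqP; rewrite -subr_eq0 (oppr_pchar2 ch2).
  exists (2, a); rewrite ?inE /= /g /= ?ae //.
  by move: nz; rewrite ae andbb.
rewrite !inE /= => x0; move: i; elim/forall_I3; rewrite /g /= => -[-> ->].
- by rewrite (negPf x0) eqxx orbT.
- by rewrite (negPf x0) eqxx.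
- by rewrite (negPf x0) (addrr_pchar2 ch2) eqxx orbT.
Qed.

(** The form is e times a quadratic whose value at a = y^2 e is (e (y^2 + y + b))^2; this never
    vanishes for nonzero e, so only the line e = 0 remains. *)
Lemma card_cubic_zeros_unipotent (b : F) : (forall x, x ^+ 2 + x != b) ->
  #|cubic_zeros (mx2 1 b 0 1)| = (1 * q.-1)%N.
Proof.
move=> Nb; rewrite mul1n.
transitivity #|setX [set~ (0 : F)] [set (0 : F)]|; last first.
  by rewrite cardsX cards1 muln1 cardsC1.
apply: eq_card => -[a e]; rewrite !inE /= xpair_eqE.
have cE : cubic (mx2 1 b 0 1) a e = e * (a ^+ 2 + a * e + b ^+ 2 * e ^+ 2).
  by rewrite /cubic !mx2E; apply: (eq_mod2 ch2 (a * b * e ^+ 2)); ring.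
rewrite cE mulf_eq0; have [-> | e0] := eqVneq e 0; first by rewrite andbT andbT.
rewrite andbF andbF /=; apply/negP=> /eqP z.
have [y ey] := sqr_surj ch2 (a / e).
case/negP: (Nb y); apply/eqP/(sqr_inj ch2) => /=.
have e20 : e ^+ 2 != 0 by rewrite expf_neq0.
apply: (mulIf e20).
have aE : a = y ^+ 2 * e by rewrite ey divfK.
rewrite aE in z; transitivity (b ^+ 2 * e ^+ 2 + ((y ^+ 2 * e) ^+ 2
  + y ^+ 2 * e * e + b ^+ 2 * e ^+ 2)); last by rewrite z addr0.
by apply: (eq_mod2 ch2 (y ^+ 3 * e ^+ 2 - b ^+ 2 * e ^+ 2)); ring.
Qed.

Lemma card_cubic_zeros_anisotropic (T : 'M[F]_2) : anisotropic T ->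
  #|cubic_zeros T| = (0 * q.-1)%N.
Proof.
move=> anT; rewrite mul0n; apply: eq_card0 => -[a e]; rewrite !inE /=.
by apply/negP=> /andP[nz /eqP /anT[a0 e0]]; rewrite a0 e0 eqxx in nz.
Qed.

Lemma Sigma18_anisotropic c : Sigma18_param ch2 c ->
  [/\ c != 0, mx2 0 c^-1 1 c^-1 \in unitmx & anisotropic (mx2 0 c^-1 1 c^-1)].
Proof.
case=> Nroot _.
have c0 : c != 0.
  apply: contraL (Nroot 0) => /eqP ->; rewrite negbK /root !hornerE.
  by rewrite expr0n.
split=> //; first by rewrite unitmx2 !mx2E mul0r mulr1 sub0r oppr_eq0 invr_neq0.
move=> a e; rewrite /cubic !mx2E => z.
have [e0 | e0] := eqVneq e 0.
  split=> //; apply/eqP; move/eqP: z; rewrite e0 !(mulr0, addr0, mul0r, mul1r).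
  by rewrite -exprS expf_eq0.
(* With X = c a / e, the form times (c/e)^3 is X (X+1)^2 + c = X^3 + X + c. *)
case/negP: (Nroot (c * a / e)); apply/rootP; rewrite !hornerE.
transitivity (c ^+ 3 / e ^+ 3 * (a * (1 * a + c^-1 * e) ^+ 2
   + e * (0 * a + c^-1 * e) ^+ 2)); last by rewrite z mulr0.
apply: (eq_mod2 ch2 (- (c ^+ 2 * a ^+ 2 / e ^+ 2))); field.
by rewrite c0 e0.
Qed.

Lemma unipotent_unit (b : F) : mx2 1 b 0 1 \in unitmx.
Proof. by rewrite unitmx2 !mx2E mulr1 mulr0 subr0 oner_neq0. Qed.

Lemma Sigma20_unipotent b c b0 : Sigma20_param ch2 b c ->
  (forall x, x ^+ 2 + x != b0) ->
  frob_equiv ch2 (mx2 1 b0 0 1) (mx2 (1 + b) 0 c 1).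
Proof.
case=> b1 trc Nb0.
have b10 : 1 + b != 0 by rewrite addr_eq0 (oppr_pchar2 ch2) eq_sym.
have sqr1D : 1 + b ^+ 2 = (1 + b) ^+ 2 by apply: (eq_mod2 ch2 (- b)); ring.
rewrite sqr1D in trc.
have [x ex] := artin_schreier_index2 ch2 Nb0 (fun x => Tr1_not_artin_schreier x
  trc).
apply: frob_equiv_trans (frob_equiv_shift ch2 ex) _; apply: frob_equiv_sym.
(* This swap takes [1+b,0;c,1] to the unipotent matrix with corner c/(1+b)^2, whose trace is 1. *)
exists (mx2 0 1 (1 + b) 0).
  by rewrite unitmx2 !mx2E mul0r mul1r sub0r oppr_eq0.
rewrite map_mx2 !mul_mx2 !pFrobenius_autE; congr mx2; try ring.
by field.
Qed.

End ZeroCounts.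

(** * The three orbits, their distributions and representatives *)

Theorem theorem4p4 (F : finFieldType) (ch2 : 2%N \in [pchar F])
    (q_ge4 : (4 <= #|F|)%N) :
  let q := #|F| in
  exists S18 S19 S20 : {vspace 'rV[F]_6} -> Prop,
    [/\ [/\ plane_Korbit S18, plane_Korbit S19 & plane_Korbit S20],
        (* the three orbits are distinct *)
        forall pi : {vspace 'rV[F]_6},
          [/\ ~ (S18 pi /\ S19 pi), ~ (S18 pi /\ S20 pi)
            & ~ (S19 pi /\ S20 pi)],
        (* the classification *)
        forall (pi : {vspace 'rV[F]_6}) (P : 'rV[F]_6)
               (HP Hpi : {vspace 'rV[F]_6}),
          \dim pi = 3%N ->
          [disjoint points pi & veronese_surface F] ->
          P != 0 -> (pi :&: nucleus_plane F)%VS = <[P]>%VS ->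
          is_H_point P HP -> is_H_plane pi Hpi -> HP = Hpi ->
          [\/ S18 pi, S19 pi | S20 pi],
        (* the point-orbit distributions *)
        [/\ forall pi, S18 pi -> OD0 pi = [:: 0; 1; 0; q ^ 2 + q]%N,
            forall pi, S19 pi -> OD0 pi = [:: 0; 1; 3 * q; q ^ 2 - 2 * q]%N
          & forall pi, S20 pi -> OD0 pi = [:: 0; 1; q; q ^ 2]%N]
      & (* the representatives *)
        [/\ (exists c, Sigma18_param ch2 c) /\
              (forall c, Sigma18_param ch2 c -> S18 (Sigma18_rep c)),
            S19 (Sigma19_rep F)
          & (exists b c, Sigma20_param ch2 b c) /\
              (forall b c, Sigma20_param ch2 b c -> S20 (Sigma20_rep b c))]].
Proof.
move=> q; have q1 : (1 < q)%N by apply: leq_trans q_ge4.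
have [c0 par0] := Sigma18_param_exists ch2.
have [c0nz uT18 anT18] := Sigma18_anisotropic par0.
(* An element of trace 1 represents the nontrivial coset of {x^2 + x}, hence the second isotropic
   class. *)
have [b0 trb0] := Tr_surj ch2.
have Nb0 x : x ^+ 2 + x != b0 by apply: Tr1_not_artin_schreier trb0.
set T18 := mx2 0 c0^-1 1 c0^-1 in uT18 anT18.
pose T20 := mx2 1 b0 0 1.
have OD18 pi : Korbit (normal_plane T18) pi -> OD0 pi = [:: 0; 1; 0;
  q ^ 2 + q]%N.
  move=> K; rewrite (OD0_Korbit ch2 q1 K) (OD0_normal ch2 uT18 q1 _
    (card_cubic_zeros_anisotropic anT18)) //.
  by rewrite muln0 subn0 mulnS addnC.
have OD19 pi : Korbit (normal_plane (1%:M : 'M[F]_2)) pi ->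
    OD0 pi = [:: 0; 1; 3 * q; q ^ 2 - 2 * q]%N.
  move=> K; rewrite (OD0_Korbit ch2 q1 K) (OD0_normal ch2 (unitmx1 _ _) q1 _
    (card_cubic_zeros_id ch2)); last by rewrite ltnS ltnW // ltnW.
  by rewrite subSS mulnBr mulnC [(q * 2)%N]mulnC.
have OD20 pi : Korbit (normal_plane T20) pi -> OD0 pi = [:: 0; 1; q; q ^ 2]%N.
  move=> K; rewrite (OD0_Korbit ch2 q1 K) (OD0_normal ch2 (unipotent_unit b0)
    q1 _
    (card_cubic_zeros_unipotent ch2 Nb0)) //.
  by rewrite muln1 subSS subn0.
exists (Korbit (normal_plane T18)), (Korbit (normal_plane (1%:M : 'M[F]_2))).
exists (Korbit (normal_plane T20)).
have q0 : (0 < q)%N by rewrite ltnW.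
split=> [|pi|pi P HP Hpi dimpi dis P0 piN isHP isHpi eH|//|].
- by split; [exists (normal_plane T18) | exists (normal_plane (1%:M : 'M[F]_2))
            | exists (normal_plane T20)]; rewrite ?dim_normal.
(* The third entries 0, 3q and q of the distributions are distinct. *)
- split=> -[].
  + move=> /OD18 e1 /OD19; rewrite e1 => -[e _].
    by move: (esym e) => /eqP; rewrite muln_eq0 /= eqn0Ngt q0.
  + by move=> /OD18 e1 /OD20; rewrite e1 => -[e _]; rewrite -e in q0.
  + move=> /OD19 e1 /OD20; rewrite e1 => -[e _]; move/eqP: e.
    by rewrite -[X in _ == X]mul1n eqn_pmul2r.
- have [T uT piT] := normal_form ch2 dimpi dis P0 piN isHP isHpi eH.
  have back T' : frob_equiv ch2 T' T -> Korbit (normal_plane T') pi.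
    by move/frob_equiv_Korbit/Korbit_trans; apply; apply: Korbit_sym.
  (* A nontrivial zero of the form leads to the second or third orbit, its absence to the first. *)
  have [/existsP[[a e] /= /andP[nz /eqP C0]] | an] := boolP
      [exists p : F * F, (p != (0, 0)) && (cubic T p.1 p.2 == 0)].
    have nz' : (a != 0) || (e != 0) by rewrite -negb_and -xpair_eqE.
    by case: (isotropic_classes ch2 uT C0 nz' Nb0) => /back;
      [constructor 2 | constructor 3].
  constructor 1; apply: back; apply: anisotropic_equiv => // a e C0.
  apply/pair_equal_spec/eqP; apply: contraR an => nz.
  by apply/existsP; exists (a, e); rewrite nz C0 eqxx.
- split.
  + split; first by exists c0.
    move=> c /Sigma18_anisotropic[cnz _ an].
    apply: Korbit_trans (Sigma18_normal cnz).
    exact/frob_equiv_Korbit/anisotropic_equiv.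
  + exact: Sigma19_normal.
  + split; first exists 0, b0.
      by split; [rewrite eq_sym oner_eq0 | rewrite expr0n addr0 divr1].
    move=> b c par; apply: Korbit_trans (Sigma20_normal ch2 b c).
    exact/frob_equiv_Korbit/(Sigma20_unipotent par Nb0).
Qed.
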